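(* For all finite sets of type variables $\Delta$, typing contexts $\Gamma$, types $\tau$ and terms $e,e'$ with $\Delta;\Gamma\vdash e:\tau$ and $\Delta;\Gamma\vdash e':\tau$: (1) $\Delta;\Gamma\vdash e\lesssim^{ciu}_{\downarrow} e':\tau$ if and only if $\Delta;\Gamma\vdash e\lesssim^{ctx}_{\downarrow} e':\tau$; (2) $\Delta;\Gamma\vdash e\lesssim^{ciu}_{\Downarrow} e':\tau$ if and only if $\Delta;\Gamma\vdash e\lesssim^{ctx}_{\Downarrow} e':\tau$; (3) consequently the CIU preorder (the intersection of $\lesssim^{ciu}_{\downarrow}$ and $\lesssim^{ciu}_{\Downarrow}$) coincides with contextual approximation $\lesssim^{ctx}$ (the intersection of $\lesssim^{ctx}_{\downarrow}$ and $\lesssim^{ctx}_{\Downarrow}$).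
   Context: Language. Types: $\tau ::= \alpha \mid \mathbf{1} \mid \tau_1\times\tau_2 \mid \tau_1\to\tau_2 \mid \mu\alpha.(\tau_1+\dots+\tau_n) \mid \forall\alpha.\tau$. Values: $v ::= x \mid \langle\rangle \mid \langle v_1,v_2\rangle \mid \lambda x.e \mid \mathsf{in}_i\,v \mid \Lambda\alpha.e$. Terms: $e ::= v \mid ? \mid \mathsf{proj}_i\,v \mid v\,e \mid \mathsf{case}\,v\,\mathsf{of}\,(\mathsf{in}_1 x_1\Rightarrow e_1\mid\dots\mid \mathsf{in}_n x_n\Rightarrow e_n) \mid v[\tau]$. Evaluation contexts: $E ::= [\,] \mid v\,E$. One-step reduction $\mapsto$: $\mathsf{proj}_i\langle v_1,v_2\rangle\mapsto v_i$; $(\lambda x.e)\,v\mapsto e[v/x]$; $(\Lambda\alpha.e)[\tau]\mapsto e[\tau/\alpha]$; $\mathsf{case}\,(\mathsf{in}_j v)\,\mathsf{of}(\dots\mid\mathsf{in}_j x_j\Rightarrow e_j\mid\dots)\mapsto e_j[v/x_j]$; $?\mapsto \underline{n}$ for every $n\in\mathbb N$; and $v\,e\mapsto v\,e'$ whenever $e\mapsto e'$. Here $\mathsf{nat}=\mu\alpha.(\mathbf 1+\alpha)$, $\underline 0=\mathsf{in}_1\langle\rangle$, $\underline{n+1}=\mathsf{in}_2\,\underline n$. Typing judgements $\Delta;\Gamma\vdash e:\tau$ ($\Delta$ a finite set of type variables containing the free type variables, $\Gamma$ a list $x_1{:}\tau_1,\dots$) are the standard ones for a call-by-value polymorphic lambda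 calculus with products, unit and iso-recursive sum types: $\mathsf{in}_j v:\mu\alpha.(\tau_1+\dots+\tau_n)$ when $v:\tau_j[\mu\alpha.(\tau_1+\dots+\tau_n)/\alpha]$; case analysis on $v:\mu\alpha.(\tau_1+\dots+\tau_n)$ types the branch $e_j$ with $x_j:\tau_j[\mu\alpha.(\tau_1+\dots+\tau_n)/\alpha]$; $?:\mathsf{nat}$; $\Lambda\alpha.e:\forall\alpha.\tau$ when $\Delta,\alpha;\Gamma\vdash e:\tau$; $v[\tau']:\tau[\tau'/\alpha]$ when $v:\forall\alpha.\tau$ and $\tau'$ is well-formed in $\Delta$. $\mathsf{Type}$ is the set of closed types; $\mathrm{Val}(\tau)$, $\mathrm{Tm}(\tau)$ are the closed values/terms of closed type $\tau$; $\mathrm{Stk}(\tau)$ is the set of evaluation contexts $E$ such that $E[e]$ is a closed well-typed term whenever $e\in\mathrm{Tm}(\tau)$; for $\Gamma$ with closed types, $\mathrm{Subst}(\Gamma)$ is the set of substitutions mapping each $x{:}\sigma\in\Gamma$ to an element of $\mathrm{Val}(\sigma)$. Observables: $e\downarrow$ ($e$ may-converges) if $e\mapsto^* v$ for some value $v$; $e$ may-diverges if there is an infinite reduction sequence from $e$; $e\Downarrow$ ($e$ must-converges) if $e$ does not may-diverge. Contextual approximation: a type-indexed relation $R$ is a set of tuples $(\Delta,\Gamma,e,e',\tau)$ with $\Delta;\Gamma\vdash e:\tau$ and $\Delta;\Gamma\vdash e':\tau$, written $\Delta;\Gamma\vdash e\,R\,e':\tau$. It is compatible if $x\,R\,x$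 for $x{:}\tau\in\Gamma$, $\langle\rangle\,R\,\langle\rangle:\mathbf 1$, $?\,R\,?:\mathsf{nat}$, and whenever corresponding immediate subterms are related (at the appropriate contexts and types) then so are $\langle v_1,v_2\rangle,\langle v_1',v_2'\rangle$; $\lambda x.e,\lambda x.e'$; $\mathsf{in}_j v,\mathsf{in}_j v'$; $\Lambda\alpha.e,\Lambda\alpha.e'$; $\mathsf{proj}_i v,\mathsf{proj}_i v'$; $v\,e, v'\,e'$; $\mathsf{case}\,v\,\mathsf{of}(\mathsf{in}_j x_j\Rightarrow e_j)_j,\mathsf{case}\,v'\,\mathsf{of}(\mathsf{in}_j x_j\Rightarrow e_j')_j$; $v[\tau'],v'[\tau']$. A precongruence is a reflexive (relating each well-typed term to itself), transitive, compatible type-indexed relation. $R$ is may-adequate (resp. must-adequate) if $\emptyset;\emptyset\vdash e\,R\,e':\tau$ and $e\downarrow$ (resp. $e\Downarrow$) imply $e'\downarrow$ (resp. $e'\Downarrow$). $\lesssim^{ctx}_{\downarrow}$ (resp. $\lesssim^{ctx}_{\Downarrow}$) is the largest may-adequate (resp. must-adequate) precongruence. CIU preorders: $\Delta;\Gamma\vdash e\lesssim^{ciu}_{\downarrow} e':\tau$ iff for all $\delta\in\mathsf{Type}^\Delta$, $\gamma\in\mathrm{Subst}(\Gamma\delta)$, $E\in\mathrm{Stk}(\tau\delta)$: $E[e\delta\gamma]\downarrow$ implies $E[e'\delta\gamma]\downarrow$; $\lesssim^{ciu}_{\Downarrow}$ is defined the same way with $\Downarrow$ in place of $\downarrow$.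 *)

(* Defs.v *)
(* Stdlib only.

   Binding is represented by de Bruijn indices, separately for type variables
   and term variables.  A finite set of type variables is therefore a number
   [D], standing for the variables 0, ..., D-1, and a context is the list of the
   types of its variables, variable 0 first. *)

From Stdlib Require Import List Relations.
Import ListNotations.

Set Implicit Arguments.

(** * Syntax *)

(* [TMu [t1; ...; tn]] is mu a. (t1 + ... + tn): it binds type variable 0 in
   every summand.  The number n of summands is an arbitrary natural number. *)
Inductive ty : Type :=
| TVar (a : nat)
| TUnit
| TProd (t1 t2 : ty)
| TArr (t1 t2 : ty)
| TMu (ts : list ty)
| TAll (t : ty).

(* Injections are numbered from 0: [VIn 0] is in_1.  [VLam] and every branch of
   [Case] bind term variable 0; [VTLam] binds type variable 0. *)
Inductive val : Type :=
| VVar (x : nat)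
| VUnit
| VPair (v1 v2 : val)
| VLam (e : tm)
| VIn (j : nat) (v : val)
| VTLam (e : tm)
with tm : Type :=
| Ret (v : val)
| Choose
| Fst (v : val)
| Snd (v : val)
| App (v : val) (e : tm)
| Case (v : val) (bs : list tm)
| TApp (v : val) (t : ty).

Coercion Ret : val >-> tm.

Inductive ectx : Type :=
| Hole
| EApp (v : val) (E : ectx).

Fixpoint plug (E : ectx) (e : tm) : tm :=
  match E with
  | Hole => e
  | EApp v E => App v (plug E e)
  end.

(** * Renaming and substitution *)

Definition scons {X : Type} (x : X) (f : nat -> X) (i : nat) : X :=
  match i with
  | 0 => x
  | S i => f i
  end.

Definition up_ren (r : nat -> nat) : nat -> nat := scons 0 (fun i => S (r i)).

Fixpoint ty_ren (r : nat -> nat) (t : ty) : ty :=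
  match t with
  | TVar a => TVar (r a)
  | TUnit => TUnit
  | TProd t1 t2 => TProd (ty_ren r t1) (ty_ren r t2)
  | TArr t1 t2 => TArr (ty_ren r t1) (ty_ren r t2)
  | TMu ts => TMu (map (ty_ren (up_ren r)) ts)
  | TAll t => TAll (ty_ren (up_ren r) t)
  end.

Definition ty_up (s : nat -> ty) : nat -> ty :=
  scons (TVar 0) (fun i => ty_ren S (s i)).

Fixpoint ty_subst (s : nat -> ty) (t : ty) : ty :=
  match t with
  | TVar a => s a
  | TUnit => TUnit
  | TProd t1 t2 => TProd (ty_subst s t1) (ty_subst s t2)
  | TArr t1 t2 => TArr (ty_subst s t1) (ty_subst s t2)
  | TMu ts => TMu (map (ty_subst (ty_up s)) ts)
  | TAll t => TAll (ty_subst (ty_up s) t)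
  end.

(* t[t'/a] for the innermost type variable a of t *)
Definition ty_inst (t' t : ty) : ty := ty_subst (scons t' TVar) t.

(* On terms, [r] and [s] act on type variables, [q] and [g] on term variables. *)
Fixpoint val_ren (r q : nat -> nat) (v : val) : val :=
  match v with
  | VVar x => VVar (q x)
  | VUnit => VUnit
  | VPair v1 v2 => VPair (val_ren r q v1) (val_ren r q v2)
  | VLam e => VLam (tm_ren r (up_ren q) e)
  | VIn j v => VIn j (val_ren r q v)
  | VTLam e => VTLam (tm_ren (up_ren r) q e)
  end
with tm_ren (r q : nat -> nat) (e : tm) : tm :=
  match e with
  | Ret v => Ret (val_ren r q v)
  | Choose => Choose
  | Fst v => Fst (val_ren r q v)
  | Snd v => Snd (val_ren r q v)
  | App v e => App (val_ren r q v) (tm_ren r q e)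
  | Case v bs => Case (val_ren r q v) (map (tm_ren r (up_ren q)) bs)
  | TApp v t => TApp (val_ren r q v) (ty_ren r t)
  end.

Definition val_up (g : nat -> val) : nat -> val :=
  scons (VVar 0) (fun i => val_ren (fun a => a) S (g i)).

Definition val_shift_ty (g : nat -> val) : nat -> val :=
  fun i => val_ren S (fun x => x) (g i).

Fixpoint val_subst (s : nat -> ty) (g : nat -> val) (v : val) : val :=
  match v with
  | VVar x => g x
  | VUnit => VUnit
  | VPair v1 v2 => VPair (val_subst s g v1) (val_subst s g v2)
  | VLam e => VLam (tm_subst s (val_up g) e)
  | VIn j v => VIn j (val_subst s g v)
  | VTLam e => VTLam (tm_subst (ty_up s) (val_shift_ty g) e)
  end
with tm_subst (s : nat -> ty) (g : nat -> val) (e : tm) : tm :=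
  match e with
  | Ret v => Ret (val_subst s g v)
  | Choose => Choose
  | Fst v => Fst (val_subst s g v)
  | Snd v => Snd (val_subst s g v)
  | App v e => App (val_subst s g v) (tm_subst s g e)
  | Case v bs => Case (val_subst s g v) (map (tm_subst s (val_up g)) bs)
  | TApp v t => TApp (val_subst s g v) (ty_subst s t)
  end.

Definition tm_tysubst (s : nat -> ty) (e : tm) : tm := tm_subst s VVar e.

Definition tm_valsubst (g : nat -> val) (e : tm) : tm := tm_subst TVar g e.

(* e[v/x] and e[t/a] for the innermost term, resp. type, variable of e *)
Definition tm_inst (v : val) (e : tm) : tm := tm_valsubst (scons v VVar) e.

Definition tm_tyinst (t : ty) (e : tm) : tm := tm_tysubst (scons t TVar) e.

(** * Reduction and observables *)

Definition TNat : ty := TMu [TUnit; TVar 0].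

Fixpoint num (n : nat) : val :=
  match n with
  | 0 => VIn 0 VUnit
  | S n => VIn 1 (num n)
  end.

Inductive step : tm -> tm -> Prop :=
| step_fst (v1 v2 : val) : step (Fst (VPair v1 v2)) v1
| step_snd (v1 v2 : val) : step (Snd (VPair v1 v2)) v2
| step_beta e (v : val) : step (App (VLam e) v) (tm_inst v e)
| step_tbeta e t : step (TApp (VTLam e) t) (tm_tyinst t e)
| step_case j v bs e :
    nth_error bs j = Some e -> step (Case (VIn j v) bs) (tm_inst v e)
| step_choose n : step Choose (num n)
| step_app v e e' : step e e' -> step (App v e) (App v e').

Definition may_conv (e : tm) : Prop :=
  exists v : val, clos_refl_trans tm step e v.

Definition may_div (e : tm) : Prop :=
  exists f : nat -> tm, f 0 = e /\ forall i, step (f i) (f (S i)).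

Definition must_conv (e : tm) : Prop := ~ may_div e.

(** * Typing *)

Inductive wf_ty : nat -> ty -> Prop :=
| wf_var D a : a < D -> wf_ty D (TVar a)
| wf_unit D : wf_ty D TUnit
| wf_prod D t1 t2 : wf_ty D t1 -> wf_ty D t2 -> wf_ty D (TProd t1 t2)
| wf_arr D t1 t2 : wf_ty D t1 -> wf_ty D t2 -> wf_ty D (TArr t1 t2)
| wf_mu D ts : (forall t, In t ts -> wf_ty (S D) t) -> wf_ty D (TMu ts)
| wf_all D t : wf_ty (S D) t -> wf_ty D (TAll t).

Definition ctx : Type := list ty.

Definition wf_ctx (D : nat) (G : ctx) : Prop := forall t, In t G -> wf_ty D t.

Definition ctx_shift (G : ctx) : ctx := map (ty_ren S) G.

(* The well-formedness premises ensure that [has_type D G e t] implies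
   [wf_ctx D G] and [wf_ty D t]. *)
Inductive has_type : nat -> ctx -> tm -> ty -> Prop :=
| ht_var D G x t :
    wf_ctx D G -> nth_error G x = Some t -> has_type D G (VVar x) t
| ht_unit D G :
    wf_ctx D G -> has_type D G VUnit TUnit
| ht_pair D G v1 v2 t1 t2 :
    has_type D G (Ret v1) t1 -> has_type D G (Ret v2) t2 ->
    has_type D G (VPair v1 v2) (TProd t1 t2)
| ht_lam D G e t1 t2 :
    has_type D (t1 :: G) e t2 -> has_type D G (VLam e) (TArr t1 t2)
| ht_in D G j v ts t :
    wf_ty D (TMu ts) -> nth_error ts j = Some t ->
    has_type D G (Ret v) (ty_inst (TMu ts) t) ->
    has_type D G (VIn j v) (TMu ts)
| ht_tlam D G e t :
    has_type (S D) (ctx_shift G) e t -> has_type D G (VTLam e) (TAll t)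
| ht_choose D G :
    wf_ctx D G -> has_type D G Choose TNat
| ht_fst D G v t1 t2 :
    has_type D G (Ret v) (TProd t1 t2) -> has_type D G (Fst v) t1
| ht_snd D G v t1 t2 :
    has_type D G (Ret v) (TProd t1 t2) -> has_type D G (Snd v) t2
| ht_app D G v e t1 t2 :
    has_type D G (Ret v) (TArr t1 t2) -> has_type D G e t1 ->
    has_type D G (App v e) t2
| ht_case D G v bs ts t :
    wf_ty D t -> has_type D G (Ret v) (TMu ts) -> length bs = length ts ->
    (forall j tj ej, nth_error ts j = Some tj -> nth_error bs j = Some ej ->
       has_type D (ty_inst (TMu ts) tj :: G) ej t) ->
    has_type D G (Case v bs) t
| ht_tapp D G v t t' :
    has_type D G (Ret v) (TAll t) -> wf_ty D t' ->
    has_type D G (TApp v t') (ty_inst t' t).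

Definition Typ (t : ty) : Prop := wf_ty 0 t.
Definition Val (t : ty) (v : val) : Prop := has_type 0 [] v t.
Definition Tm (t : ty) (e : tm) : Prop := has_type 0 [] e t.

Definition Stk (t : ty) (E : ectx) : Prop :=
  forall e, Tm t e -> exists t', Tm t' (plug E e).

(* The values of [d] and [g] on variables outside D and G are irrelevant. *)
Definition TypSubst (D : nat) (d : nat -> ty) : Prop :=
  forall a, a < D -> Typ (d a).

Definition Subst (G : ctx) (g : nat -> val) : Prop :=
  forall x t, nth_error G x = Some t -> Val t (g x).

(** * Contextual approximation *)

Definition trel : Type := nat -> ctx -> tm -> tm -> ty -> Prop.

Definition type_indexed (R : trel) : Prop :=
  forall D G e e' t, R D G e e' t -> has_type D G e t /\ has_type D G e' t.

Record compatible (R : trel) : Prop := {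
  compat_var : forall D G x t,
    wf_ctx D G -> nth_error G x = Some t -> R D G (VVar x) (VVar x) t;
  compat_unit : forall D G,
    wf_ctx D G -> R D G VUnit VUnit TUnit;
  compat_choose : forall D G,
    wf_ctx D G -> R D G Choose Choose TNat;
  compat_pair : forall D G v1 v1' v2 v2' t1 t2,
    R D G (Ret v1) (Ret v1') t1 -> R D G (Ret v2) (Ret v2') t2 ->
    R D G (VPair v1 v2) (VPair v1' v2') (TProd t1 t2);
  compat_lam : forall D G e e' t1 t2,
    R D (t1 :: G) e e' t2 -> R D G (VLam e) (VLam e') (TArr t1 t2);
  compat_in : forall D G j v v' ts t,
    wf_ty D (TMu ts) -> nth_error ts j = Some t ->
    R D G (Ret v) (Ret v') (ty_inst (TMu ts) t) ->
    R D G (VIn j v) (VIn j v') (TMu ts);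
  compat_tlam : forall D G e e' t,
    R (S D) (ctx_shift G) e e' t -> R D G (VTLam e) (VTLam e') (TAll t);
  compat_fst : forall D G v v' t1 t2,
    R D G (Ret v) (Ret v') (TProd t1 t2) -> R D G (Fst v) (Fst v') t1;
  compat_snd : forall D G v v' t1 t2,
    R D G (Ret v) (Ret v') (TProd t1 t2) -> R D G (Snd v) (Snd v') t2;
  compat_app : forall D G v v' e e' t1 t2,
    R D G (Ret v) (Ret v') (TArr t1 t2) -> R D G e e' t1 ->
    R D G (App v e) (App v' e') t2;
  compat_case : forall D G v v' bs bs' ts t,
    wf_ty D t -> R D G (Ret v) (Ret v') (TMu ts) ->
    length bs = length ts -> length bs' = length ts ->
    (forall j tj ej ej', nth_error ts j = Some tj ->
       nth_error bs j = Some ej -> nth_error bs' j = Some ej' ->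
       R D (ty_inst (TMu ts) tj :: G) ej ej' t) ->
    R D G (Case v bs) (Case v' bs') t;
  compat_tapp : forall D G v v' t t',
    R D G (Ret v) (Ret v') (TAll t) -> wf_ty D t' ->
    R D G (TApp v t') (TApp v' t') (ty_inst t' t)
}.

Record precongruence (R : trel) : Prop := {
  prec_typed : type_indexed R;
  prec_refl : forall D G e t, has_type D G e t -> R D G e e t;
  prec_trans : forall D G e1 e2 e3 t,
    R D G e1 e2 t -> R D G e2 e3 t -> R D G e1 e3 t;
  prec_compat : compatible R
}.

(* [obs] is either [may_conv] or [must_conv]. *)
Definition adequate (obs : tm -> Prop) (R : trel) : Prop :=
  forall e e' t, R 0 [] e e' t -> obs e -> obs e'.

Definition largest (P : trel -> Prop) (R : trel) : Prop :=
  P R /\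
  forall R', P R' -> forall D G e e' t, R' D G e e' t -> R D G e e' t.

(* Membership in the largest adequate precongruence.  A largest relation is
   unique up to extensional equality; its existence is part of the assertion. *)
Definition ctx_approx (obs : tm -> Prop) : trel := fun D G e e' t =>
  exists R : trel,
    largest (fun R' => precongruence R' /\ adequate obs R') R /\ R D G e e' t.

Definition ctx_may : trel := ctx_approx may_conv.
Definition ctx_must : trel := ctx_approx must_conv.

(** * CIU preorders *)

Definition ciu_approx (obs : tm -> Prop) : trel := fun D G e e' t =>
  has_type D G e t /\ has_type D G e' t /\
  forall d, TypSubst D d ->
  forall g, Subst (map (ty_subst d) G) g ->
  forall E, Stk (ty_subst d t) E ->
    obs (plug E (tm_valsubst g (tm_tysubst d e))) ->
    obs (plug E (tm_valsubst g (tm_tysubst d e'))).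

Definition ciu_may : trel := ciu_approx may_conv.
Definition ciu_must : trel := ciu_approx must_conv.

Definition trel_inter (R1 R2 : trel) : trel := fun D G e e' t =>
  R1 D G e e' t /\ R2 D G e e' t.

Definition ciu : trel := trel_inter ciu_may ciu_must.
Definition ctx_both : trel := trel_inter ctx_may ctx_must.

(* Main.v *)
(* The CIU preorder is itself the largest adequate precongruence.

   It contains every adequate precongruence R: R-related open terms remain related under
   lambda and Lambda, and applying these abstractions to the closing values and types only adds
   deterministic steps.  In the end the stack has to be well-typed uniformly in the plugged term;
   this holds because every closed type t is the only type of some closed term.

   It is a precongruence: all term formers but the binders are compatible because
   [E[(\x. C) v]] and [E[C[v/x]]] converge and diverge together.  For two abstractions w and w'
   with CIU-related bodies, run C[w] and C[w'] in lockstep for arbitrary open C.  Steps of C are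
   shared; when C = E[x v], the left side reduces to E[e[v]][w], which the simulation compares
   with E[e[v]][w'], and the CIU hypothesis exchanges the body e for e'. *)

From Stdlib Require Import List Relations Lia Classical.
From Stdlib Require Import IndefiniteDescription FunctionalExtensionality.
Require Import Defs.
Import ListNotations.

(** * Induction principles for syntax nested through lists *)

Lemma ty_nested_ind (P : ty -> Prop)
  (Hvar : forall a, P (TVar a)) (Hunit : P TUnit)
  (Hprod : forall t1 t2, P t1 -> P t2 -> P (TProd t1 t2))
  (Harr : forall t1 t2, P t1 -> P t2 -> P (TArr t1 t2))
  (Hmu : forall ts, (forall t, In t ts -> P t) -> P (TMu ts))
  (Hall : forall t, P t -> P (TAll t)) : forall t, P t.
Proof.
  fix F 1. intros [a| |t1 t2|t1 t2|ts|t].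
  - apply Hvar.
  - apply Hunit.
  - apply Hprod; apply F.
  - apply Harr; apply F.
  (* The inner induction runs through the list of summands, so every call of [F] is on a
     structurally smaller type. *)
  - apply Hmu. induction ts as [|t ts IH]; simpl; intros u Hu; [contradiction|].
    destruct Hu as [<-|Hu]; [apply F|apply IH; exact Hu].
  - apply Hall; apply F.
Qed.

Lemma val_tm_nested_ind (P : val -> Prop) (Q : tm -> Prop)
  (Hvar : forall x, P (VVar x)) (Hunit : P VUnit)
  (Hpair : forall v1 v2, P v1 -> P v2 -> P (VPair v1 v2))
  (Hlam : forall e, Q e -> P (VLam e))
  (Hin : forall j v, P v -> P (VIn j v))
  (Htlam : forall e, Q e -> P (VTLam e))
  (Hret : forall v, P v -> Q (Ret v)) (Hchoose : Q Choose)
  (Hfst : forall v, P v -> Q (Fst v)) (Hsnd : forall v, P v -> Q (Snd v))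
  (Happ : forall v e, P v -> Q e -> Q (App v e))
  (Hcase : forall v bs, P v -> (forall e, In e bs -> Q e) -> Q (Case v bs))
  (Htapp : forall v t, P v -> Q (TApp v t)) :
  (forall v, P v) /\ (forall e, Q e).
Proof.
  let ih_cases :=
    first [ apply Hvar | apply Hunit | apply Hpair; apply F | apply Hlam; apply G
          | apply Hin; apply F | apply Htlam; apply G | apply Hret; apply F | apply Hchoose
          | apply Hfst; apply F | apply Hsnd; apply F | apply Happ; [apply F|apply G]
          | apply Htapp; apply F
          | apply Hcase; [apply F|];
            match goal with |- forall e, In e ?l -> _ => induction l as [|b bs' IH] end;
            simpl; intros u Hu; [contradiction|];
            destruct Hu as [<-|Hu]; [apply G|apply IH; exact Hu] ] in
  split;
  [ fix F 1 with (G (e : tm) {struct e} : Q e); [intros v|]; [destruct v|destruct e]; ih_cases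
  | fix G 1 with (F (v : val) {struct v} : P v); [intros e|]; [destruct e|destruct v]; ih_cases ].
Qed.

Ltac fun_ext := let i := fresh "i" in extensionality i; destruct i as [|i]; simpl; auto.

(** * Substitution algebra *)

Lemma up_ren_id : up_ren (fun a => a) = (fun a => a).
Proof. fun_ext. Qed.

Lemma ty_ren_id t : ty_ren (fun a => a) t = t.
Proof.
  induction t using ty_nested_ind; simpl; rewrite ?up_ren_id; f_equal; auto.
  rewrite <- map_id. apply map_ext_in. auto.
Qed.

Lemma ty_up_var r : ty_up (fun a => TVar (r a)) = (fun a => TVar (up_ren r a)).
Proof. fun_ext. Qed.

Lemma ty_ren_as_subst t : forall r, ty_ren r t = ty_subst (fun a => TVar (r a)) t.
Proof.
  induction t using ty_nested_ind; intros r; simpl; rewrite ?ty_up_var; f_equal; auto.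
  apply map_ext_in. auto.
Qed.

Lemma ty_subst_id t : ty_subst TVar t = t.
Proof. exact (eq_trans (eq_sym (ty_ren_as_subst t (fun a => a))) (ty_ren_id t)). Qed.

Lemma ty_up_ren s r : (fun a => ty_up s (up_ren r a)) = ty_up (fun a => s (r a)).
Proof. fun_ext. Qed.

(** The composition laws are proved in the order substitution after renaming, renaming after
    renaming, renaming after substitution, substitution after substitution: passing under a binder
    in a later law uses the earlier ones. The same order recurs for terms. *)
Lemma ty_subst_ren t : forall s r, ty_subst s (ty_ren r t) = ty_subst (fun a => s (r a)) t.
Proof.
  induction t using ty_nested_ind; intros s r; simpl; rewrite <- ?(ty_up_ren s r); f_equal; auto.
  rewrite map_map. apply map_ext_in. auto.
Qed.

Lemma ty_ren_ren r' r t : ty_ren r' (ty_ren r t) = ty_ren (fun a => r' (r a)) t.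
Proof.
  rewrite (ty_ren_as_subst (ty_ren r t)), ty_subst_ren. symmetry. apply ty_ren_as_subst.
Qed.

Lemma ty_ren_up s r : (fun a => ty_ren (up_ren r) (ty_up s a)) = ty_up (fun a => ty_ren r (s a)).
Proof. fun_ext. rewrite !ty_ren_ren. reflexivity. Qed.

Lemma ty_ren_subst t : forall r s, ty_ren r (ty_subst s t) = ty_subst (fun a => ty_ren r (s a)) t.
Proof.
  induction t using ty_nested_ind; intros r s; simpl; rewrite <- ?(ty_ren_up s r); f_equal; auto.
  rewrite map_map. apply map_ext_in. auto.
Qed.

Lemma ty_subst_up s' s :
  (fun a => ty_subst (ty_up s') (ty_up s a)) = ty_up (fun a => ty_subst s' (s a)).
Proof. fun_ext. rewrite ty_subst_ren, ty_ren_subst. reflexivity. Qed.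

Lemma ty_subst_subst t : forall s' s,
  ty_subst s' (ty_subst s t) = ty_subst (fun a => ty_subst s' (s a)) t.
Proof.
  induction t using ty_nested_ind; intros s' s; simpl; rewrite <- ?(ty_subst_up s' s);
    f_equal; auto.
  rewrite map_map. apply map_ext_in. auto.
Qed.

Lemma ty_subst_inst s t' t :
  ty_subst s (ty_inst t' t) = ty_inst (ty_subst s t') (ty_subst (ty_up s) t).
Proof.
  unfold ty_inst. rewrite !ty_subst_subst. f_equal.
  fun_ext. rewrite ty_subst_ren. symmetry. apply ty_subst_id.
Qed.

Lemma ty_ren_inst r t' t :
  ty_ren r (ty_inst t' t) = ty_inst (ty_ren r t') (ty_ren (up_ren r) t).
Proof. rewrite !ty_ren_as_subst, ty_subst_inst, ty_up_var. reflexivity. Qed.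

Lemma ctx_shift_subst s t' G :
  map (ty_subst (scons t' s)) (ctx_shift G) = map (ty_subst s) G.
Proof.
  unfold ctx_shift. rewrite map_map. apply map_ext. intros t. rewrite ty_subst_ren. reflexivity.
Qed.

Lemma val_tm_ren_id :
  (forall v, val_ren (fun a => a) (fun x => x) v = v) /\
  (forall e, tm_ren (fun a => a) (fun x => x) e = e).
Proof.
  apply val_tm_nested_ind; intros; simpl; rewrite ?up_ren_id, ?ty_ren_id; f_equal; auto.
  rewrite <- map_id. apply map_ext_in. auto.
Qed.

Definition val_ren_id := proj1 val_tm_ren_id.
Definition tm_ren_id := proj2 val_tm_ren_id.

Lemma val_up_var q : val_up (fun x => VVar (q x)) = (fun x => VVar (up_ren q x)).
Proof. fun_ext. Qed.

Lemma val_tm_ren_as_subst :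
  (forall v r q, val_ren r q v = val_subst (fun a => TVar (r a)) (fun x => VVar (q x)) v) /\
  (forall e r q, tm_ren r q e = tm_subst (fun a => TVar (r a)) (fun x => VVar (q x)) e).
Proof.
  apply val_tm_nested_ind; intros; simpl;
    rewrite ?ty_up_var, ?val_up_var, ?ty_ren_as_subst; f_equal; auto.
  apply map_ext_in. auto.
Qed.

Definition val_ren_as_subst := proj1 val_tm_ren_as_subst.
Definition tm_ren_as_subst := proj2 val_tm_ren_as_subst.

Lemma val_subst_id v : val_subst TVar VVar v = v.
Proof. exact (eq_trans (eq_sym (val_ren_as_subst v (fun a => a) (fun x => x))) (val_ren_id v)). Qed.

Lemma tm_subst_id e : tm_subst TVar VVar e = e.
Proof. exact (eq_trans (eq_sym (tm_ren_as_subst e (fun a => a) (fun x => x))) (tm_ren_id e)). Qed.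

Lemma val_up_ren g q : (fun x => val_up g (up_ren q x)) = val_up (fun x => g (q x)).
Proof. fun_ext. Qed.

Lemma val_tm_subst_ren :
  (forall v s g r q,
     val_subst s g (val_ren r q v) = val_subst (fun a => s (r a)) (fun x => g (q x)) v) /\
  (forall e s g r q,
     tm_subst s g (tm_ren r q e) = tm_subst (fun a => s (r a)) (fun x => g (q x)) e).
Proof.
  apply val_tm_nested_ind; intros; simpl;
    rewrite <- ?(ty_up_ren s r), <- ?(val_up_ren g q), ?ty_subst_ren; f_equal; auto.
  - rewrite H. reflexivity.
  - rewrite map_map. apply map_ext_in. auto.
Qed.

Definition val_subst_ren := proj1 val_tm_subst_ren.

Lemma val_ren_ren r' q' r q v :
  val_ren r' q' (val_ren r q v) = val_ren (fun a => r' (r a)) (fun x => q' (q x)) v.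
Proof.
  rewrite (val_ren_as_subst (val_ren r q v)), val_subst_ren. symmetry. apply val_ren_as_subst.
Qed.

Lemma val_ren_up r q g :
  (fun x => val_ren r (up_ren q) (val_up g x)) = val_up (fun x => val_ren r q (g x)).
Proof. fun_ext. rewrite !val_ren_ren. reflexivity. Qed.

Lemma val_ren_shift_ty r q g :
  (fun x => val_ren (up_ren r) q (val_shift_ty g x)) = val_shift_ty (fun x => val_ren r q (g x)).
Proof. extensionality x. unfold val_shift_ty. rewrite !val_ren_ren. reflexivity. Qed.

Lemma val_tm_ren_subst :
  (forall v r q s g,
     val_ren r q (val_subst s g v)
     = val_subst (fun a => ty_ren r (s a)) (fun x => val_ren r q (g x)) v) /\
  (forall e r q s g,
     tm_ren r q (tm_subst s g e)
     = tm_subst (fun a => ty_ren r (s a)) (fun x => val_ren r q (g x)) e).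
Proof.
  apply val_tm_nested_ind; intros; simpl;
    rewrite <- ?(ty_ren_up s r), <- ?(val_ren_up r q g), <- ?(val_ren_shift_ty r q g),
      ?ty_ren_subst; f_equal; auto.
  rewrite map_map. apply map_ext_in. auto.
Qed.

Definition val_ren_subst := proj1 val_tm_ren_subst.

Lemma val_subst_up s' g' g :
  (fun x => val_subst s' (val_up g') (val_up g x)) = val_up (fun x => val_subst s' g' (g x)).
Proof.
  fun_ext. rewrite val_subst_ren, val_ren_subst. simpl.
  f_equal. extensionality a. symmetry. apply ty_ren_id.
Qed.

Lemma val_subst_shift_ty s' g' g :
  (fun x => val_subst (ty_up s') (val_shift_ty g') (val_shift_ty g x))
  = val_shift_ty (fun x => val_subst s' g' (g x)).
Proof.
  extensionality x. unfold val_shift_ty. rewrite val_subst_ren, val_ren_subst. reflexivity.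
Qed.

Lemma val_tm_subst_subst :
  (forall v s' g' s g,
     val_subst s' g' (val_subst s g v)
     = val_subst (fun a => ty_subst s' (s a)) (fun x => val_subst s' g' (g x)) v) /\
  (forall e s' g' s g,
     tm_subst s' g' (tm_subst s g e)
     = tm_subst (fun a => ty_subst s' (s a)) (fun x => val_subst s' g' (g x)) e).
Proof.
  apply val_tm_nested_ind; intros; simpl;
    rewrite <- ?(ty_subst_up s' s), <- ?(val_subst_up s' g' g),
      <- ?(val_subst_shift_ty s' g' g), ?ty_subst_subst;
    f_equal; auto.
  rewrite map_map. apply map_ext_in. auto.
Qed.

Definition tm_subst_subst := proj2 val_tm_subst_subst.

(** Closing a body under its binder and then supplying the argument is a single closing substitution
    extended by that argument. In this form a CIU hypothesis on an open body applies to a closed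
    abstraction. *)
Lemma tm_inst_subst v s g e :
  tm_inst v (tm_subst s (val_up g) e) = tm_subst s (scons v g) e.
Proof.
  unfold tm_inst, tm_valsubst. rewrite tm_subst_subst. f_equal.
  - extensionality a. apply ty_subst_id.
  - fun_ext. rewrite val_subst_ren. apply val_subst_id.
Qed.

Lemma tm_subst_inst s g v e :
  tm_subst s g (tm_inst v e) = tm_inst (val_subst s g v) (tm_subst s (val_up g) e).
Proof.
  rewrite tm_inst_subst. unfold tm_inst, tm_valsubst. rewrite tm_subst_subst. f_equal. fun_ext.
Qed.

Lemma tm_tyinst_subst t s g e :
  tm_tyinst t (tm_subst (ty_up s) (val_shift_ty g) e) = tm_subst (scons t s) g e.
Proof.
  unfold tm_tyinst, tm_tysubst. rewrite tm_subst_subst. f_equal.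
  - fun_ext. rewrite ty_subst_ren. apply ty_subst_id.
  - extensionality x. unfold val_shift_ty. rewrite val_subst_ren. apply val_subst_id.
Qed.

Lemma tm_subst_tyinst s g t e :
  tm_subst s g (tm_tyinst t e) = tm_tyinst (ty_subst s t) (tm_subst (ty_up s) (val_shift_ty g) e).
Proof.
  rewrite tm_tyinst_subst. unfold tm_tyinst, tm_tysubst. rewrite tm_subst_subst. f_equal. fun_ext.
Qed.

(** The second substitution is the identity on types, so the two stages in the definition of CIU
    approximation fuse into one simultaneous substitution. *)
Lemma tm_val_ty_subst g d e : tm_valsubst g (tm_tysubst d e) = tm_subst d g e.
Proof.
  unfold tm_valsubst, tm_tysubst. rewrite tm_subst_subst. f_equal.
  extensionality a. apply ty_subst_id.
Qed.

(** * Typing *)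

Lemma wf_ty_ren D t : wf_ty D t -> forall D' r,
  (forall a, a < D -> r a < D') -> wf_ty D' (ty_ren r t).
Proof.
  induction 1; intros D' r Hr; simpl; constructor; auto.
  - intros t Ht. apply in_map_iff in Ht as (u & <- & Hu). apply H0; [exact Hu|].
    intros [|a] Ha; simpl; [lia|]. specialize (Hr a). lia.
  - apply IHwf_ty. intros [|a] Ha; simpl; [lia|]. specialize (Hr a). lia.
Qed.

(** Serves to recover the well-formedness of [G] from that of [ctx_shift G] when typing goes under a
    type abstraction. *)
Lemma wf_ty_ren_inv t : forall D D' r,
  wf_ty D' (ty_ren r t) -> (forall a, r a < D' -> a < D) -> wf_ty D t.
Proof.
  induction t using ty_nested_ind; intros D D' r Hw Hr; simpl in Hw; inversion Hw; subst;
    constructor; eauto.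
  - intros t Ht. apply (H t Ht (S D) (S D') (up_ren r)).
    + match goal with [ K : forall t, In t _ -> _ |- _ ] => apply K end. apply in_map. exact Ht.
    + intros [|a] Ha; simpl in Ha; [lia|]. specialize (Hr a). lia.
  - apply (IHt (S D) (S D') (up_ren r)); [assumption|].
    intros [|a] Ha; simpl in Ha; [lia|]. specialize (Hr a). lia.
Qed.

Lemma wf_ty_up D D' s :
  (forall a, a < D -> wf_ty D' (s a)) -> forall a, a < S D -> wf_ty (S D') (ty_up s a).
Proof.
  intros Hs [|a] Ha; simpl.
  - constructor. lia.
  - apply wf_ty_ren with (D := D'); [apply Hs|]; intros; lia.
Qed.

Lemma wf_ty_subst D t : wf_ty D t -> forall D' s,
  (forall a, a < D -> wf_ty D' (s a)) -> wf_ty D' (ty_subst s t).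
Proof.
  induction 1; intros D' s Hs; simpl; auto; constructor; eauto using wf_ty_up.
  intros t Ht. apply in_map_iff in Ht as (u & <- & Hu). eauto using wf_ty_up.
Qed.

Lemma wf_ty_inst D t' t : wf_ty D t' -> wf_ty (S D) t -> wf_ty D (ty_inst t' t).
Proof.
  intros H' H. apply wf_ty_subst with (1 := H).
  intros [|a] Ha; simpl; [exact H'|constructor; lia].
Qed.

Lemma wf_ctx_cons D t G : wf_ty D t -> wf_ctx D G -> wf_ctx D (t :: G).
Proof. intros Ht HG u [<-|Hu]; auto. Qed.

Lemma wf_ctx_nil D : wf_ctx D [].
Proof. intros t []. Qed.

Lemma wf_ctx_shift D G : wf_ctx D G -> wf_ctx (S D) (ctx_shift G).
Proof.
  intros HG t Ht. apply in_map_iff in Ht as (u & <- & Hu).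
  apply wf_ty_ren with (1 := HG u Hu). intros; lia.
Qed.

Lemma has_type_wf D G e t : has_type D G e t -> wf_ctx D G /\ wf_ty D t.
Proof.
  induction 1; repeat match goal with [ H : _ /\ _ |- _ ] => destruct H end;
    repeat match goal with [ H : wf_ty _ (TProd _ _) |- _ ] => inversion H; subst; clear H
           | [ H : wf_ty _ (TArr _ _) |- _ ] => inversion H; subst; clear H
           | [ H : wf_ty _ (TAll _) |- _ ] => inversion H; subst; clear H end;
    split; auto using wf_ty_inst; try (constructor; auto; fail).
  - apply nth_error_In in H0. auto.
  - intros u Hu. apply H0. right. exact Hu.
  - constructor; auto. apply H0. left. reflexivity.
  - intros u Hu. apply wf_ty_ren_inv with (D' := S D) (r := S); [|intros; lia].
    apply H0. apply in_map. exact Hu.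
  - unfold TNat. constructor. intros u [<-|[<-|[]]]; constructor; lia.
Qed.

Lemma has_type_ren D G e t : has_type D G e t -> forall D' G' r q,
  (forall a, a < D -> r a < D') -> wf_ctx D' G' ->
  (forall x u, nth_error G x = Some u -> nth_error G' (q x) = Some (ty_ren r u)) ->
  has_type D' G' (tm_ren r q e) (ty_ren r t).
Proof.
  assert (Hup : forall D D' r, (forall a, a < D -> r a < D') ->
                forall a, a < S D -> up_ren r a < S D').
  { intros D0 D' r Hr [|a] Ha; simpl; [lia|]. specialize (Hr a). lia. }
  assert (Hcons : forall G G' r q u,
    (forall x u, nth_error G x = Some u -> nth_error G' (q x) = Some (ty_ren r u)) ->
    forall x u', nth_error (u :: G) x = Some u' ->
      nth_error (ty_ren r u :: G') (up_ren q x) = Some (ty_ren r u')).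
  { intros G0 G' r q u Hq [|x] u' Hx; simpl in *; [congruence|auto]. }
  induction 1; intros D' G' r q Hr HG' Hq; simpl.
  - constructor; auto.
  - constructor; auto.
  - constructor; [apply (IHhas_type1 D' G' r q)|apply (IHhas_type2 D' G' r q)]; auto.
  - constructor. apply IHhas_type; [exact Hr| |apply Hcons; exact Hq].
    apply wf_ctx_cons; [|exact HG'].
    apply wf_ty_ren with (D := D); [|exact Hr].
    apply has_type_wf in H as [H _]. apply H. left. reflexivity.
  - eapply ht_in with (t := ty_ren (up_ren r) t).
    + apply (@wf_ty_ren D (TMu ts)); auto.
    + rewrite nth_error_map, H0. reflexivity.
    + specialize (IHhas_type D' G' r q Hr HG' Hq). rewrite ty_ren_inst in IHhas_type.
      exact IHhas_type.
  - constructor. apply IHhas_type; [eauto|apply wf_ctx_shift; exact HG'|].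
    intros x u Hx. unfold ctx_shift in *. rewrite nth_error_map in *.
    destruct (nth_error G x) as [w|] eqn:E; simpl in Hx; [|discriminate].
    rewrite (Hq _ _ E). simpl. injection Hx as <-. rewrite !ty_ren_ren. reflexivity.
  - constructor. exact HG'.
  - econstructor. apply (IHhas_type D' G' r q); auto.
  - econstructor. apply (IHhas_type D' G' r q); auto.
  - econstructor; [apply (IHhas_type1 D' G' r q)|]; auto.
  - eapply ht_case with (ts := map (ty_ren (up_ren r)) ts).
    + apply wf_ty_ren with (1 := H). exact Hr.
    + apply (IHhas_type D' G' r q); auto.
    + rewrite !length_map. exact H1.
    + intros j tj ej Htj Hej. rewrite nth_error_map in Htj, Hej.
      destruct (nth_error ts j) as [u|] eqn:Eu; simpl in Htj; [injection Htj as <-|discriminate].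
      destruct (nth_error bs j) as [b|] eqn:Eb; simpl in Hej; [injection Hej as <-|discriminate].
      change (TMu (map (ty_ren (up_ren r)) ts)) with (ty_ren r (TMu ts)).
      rewrite <- ty_ren_inst. apply (H3 _ _ _ Eu Eb); [exact Hr| |apply Hcons; exact Hq].
      apply wf_ctx_cons; [|exact HG']. specialize (H2 _ _ _ Eu Eb).
      apply has_type_wf in H2 as [Hw _]. apply wf_ty_ren with (D := D); [|exact Hr].
      apply Hw. left. reflexivity.
  - rewrite ty_ren_inst. constructor; [apply (IHhas_type D' G' r q); auto|].
    apply wf_ty_ren with (1 := H0). exact Hr.
Qed.

(** Variable 0 is the head of the context, so entries appended at the far end leave all indices
    unchanged and the renaming involved is the identity. *)
Lemma has_type_weaken_end D G G' e t :
  has_type D G e t -> wf_ctx D G' -> has_type D (G ++ G') e t.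
Proof.
  intros H HG'. rewrite <- (tm_ren_id e), <- (ty_ren_id t).
  apply has_type_ren with (1 := H).
  - auto.
  - intros u Hu. apply in_app_or in Hu as [Hu|Hu]; [|auto]. apply (has_type_wf _ _ _ _ H). exact Hu.
  - intros x u Hx. rewrite ty_ren_id, nth_error_app1; [exact Hx|].
    apply nth_error_Some. congruence.
Qed.

Lemma has_type_subst D G e t : has_type D G e t -> forall D' G' s (g : nat -> val),
  (forall a, a < D -> wf_ty D' (s a)) -> wf_ctx D' G' ->
  (forall x u, nth_error G x = Some u -> has_type D' G' (g x) (ty_subst s u)) ->
  has_type D' G' (tm_subst s g e) (ty_subst s t).
Proof.
  assert (Hcons : forall D' G G' s (g : nat -> val) u, wf_ctx D' G' -> wf_ty D' (ty_subst s u) ->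
    (forall x u, nth_error G x = Some u -> has_type D' G' (g x) (ty_subst s u)) ->
    forall x u', nth_error (u :: G) x = Some u' ->
      has_type D' (ty_subst s u :: G') (val_up g x) (ty_subst s u')).
  { intros D' G0 G' s g u HG' Hu Hg [|x] u' Hx; simpl in *.
    - injection Hx as <-. constructor; [apply wf_ctx_cons; auto|reflexivity].
    (* Shifting by one term variable is a renaming that fixes types; the goal is rewritten to
       display that identity renaming. *)
    - rewrite <- (ty_ren_id (ty_subst s u')).
      change (Ret (val_ren (fun a => a) S (g x))) with (tm_ren (fun a => a) S (g x)).
      apply has_type_ren with (1 := Hg _ _ Hx); auto using wf_ctx_cons.
      intros y w Hy. rewrite ty_ren_id. exact Hy. }
  induction 1; intros D' G' s g Hs HG' Hg; simpl.
  - auto.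
  - constructor; auto.
  - constructor; [apply IHhas_type1|apply IHhas_type2]; auto.
  - apply has_type_wf in H as [Hw _].
    assert (wf_ty D' (ty_subst s t1)).
    { apply wf_ty_subst with (D := D); [|exact Hs]. apply Hw. left. reflexivity. }
    constructor. apply IHhas_type; [exact Hs|apply wf_ctx_cons; auto|apply Hcons; auto].
  - eapply ht_in with (t := ty_subst (ty_up s) t).
    + apply (@wf_ty_subst D (TMu ts)); auto.
    + rewrite nth_error_map, H0. reflexivity.
    + specialize (IHhas_type D' G' s g Hs HG' Hg). rewrite ty_subst_inst in IHhas_type.
      exact IHhas_type.
  - constructor. apply IHhas_type; [apply wf_ty_up; exact Hs|apply wf_ctx_shift; exact HG'|].
    intros x u Hx. unfold ctx_shift in Hx. rewrite nth_error_map in Hx.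
    destruct (nth_error G x) as [w|] eqn:E; simpl in Hx; [injection Hx as <-|discriminate].
    rewrite ty_subst_ren. change (fun a => ty_up s (S a)) with (fun a => ty_ren S (s a)).
    rewrite <- ty_ren_subst.
    change (Ret (val_shift_ty g x)) with (tm_ren S (fun x => x) (g x)).
    apply has_type_ren with (1 := Hg _ _ E); [intros; lia|apply wf_ctx_shift; exact HG'|].
    intros y v Hy. unfold ctx_shift. rewrite nth_error_map, Hy. reflexivity.
  - constructor. exact HG'.
  - econstructor. apply (IHhas_type D' G' s g); auto.
  - econstructor. apply (IHhas_type D' G' s g); auto.
  - econstructor; [apply (IHhas_type1 D' G' s g)|]; auto.
  - eapply ht_case with (ts := map (ty_subst (ty_up s)) ts).
    + apply wf_ty_subst with (1 := H). exact Hs.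
    + apply (IHhas_type D' G' s g); auto.
    + rewrite !length_map. exact H1.
    + intros j tj ej Htj Hej. rewrite nth_error_map in Htj, Hej.
      destruct (nth_error ts j) as [u|] eqn:Eu; simpl in Htj; [injection Htj as <-|discriminate].
      destruct (nth_error bs j) as [b|] eqn:Eb; simpl in Hej; [injection Hej as <-|discriminate].
      change (TMu (map (ty_subst (ty_up s)) ts)) with (ty_subst s (TMu ts)).
      rewrite <- ty_subst_inst. specialize (H2 _ _ _ Eu Eb).
      apply has_type_wf in H2 as [Hw _].
      assert (wf_ty D' (ty_subst s (ty_inst (TMu ts) u))).
      { apply wf_ty_subst with (D := D); [|exact Hs]. apply Hw. left. reflexivity. }
      apply (H3 _ _ _ Eu Eb); [exact Hs|apply wf_ctx_cons; auto|apply Hcons; auto].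
  - rewrite ty_subst_inst. constructor; [apply (IHhas_type D' G' s g); auto|].
    apply wf_ty_subst with (1 := H0). exact Hs.
Qed.

Lemma has_type_inst D G v e t1 t :
  has_type D (t1 :: G) e t -> has_type D G (Ret v) t1 -> has_type D G (tm_inst v e) t.
Proof.
  intros He Hv. rewrite <- (ty_subst_id t). apply has_type_subst with (1 := He).
  - intros a Ha. constructor. exact Ha.
  - apply (has_type_wf _ _ _ _ Hv).
  - intros [|x] u Hx; simpl in *; rewrite ty_subst_id.
    + congruence.
    + constructor; [apply (has_type_wf _ _ _ _ Hv)|exact Hx].
Qed.

Lemma has_type_tyinst D G e t' t :
  has_type (S D) (ctx_shift G) e t -> wf_ctx D G -> wf_ty D t' ->
  has_type D G (tm_tyinst t' e) (ty_inst t' t).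
Proof.
  intros He HG Ht'. apply has_type_subst with (1 := He).
  - intros [|a] Ha; simpl; [exact Ht'|constructor; lia].
  - exact HG.
  - intros x u Hx. unfold ctx_shift in Hx. rewrite nth_error_map in Hx.
    destruct (nth_error G x) as [w|] eqn:E; simpl in Hx; [injection Hx as <-|discriminate].
    rewrite ty_subst_ren. change (ty_subst (fun a => scons t' TVar (S a)) w) with (ty_subst TVar w).
    rewrite ty_subst_id. constructor; auto.
Qed.

Lemma has_type_num D G n : wf_ctx D G -> has_type D G (num n) TNat.
Proof.
  intros HG.
  assert (wf_ty D TNat).
  { constructor. intros u [<-|[<-|[]]]; constructor; lia. }
  induction n as [|n IH]; simpl.
  - apply ht_in with (t := TUnit); auto. constructor. exact HG.
  - apply ht_in with (t := TVar 0); auto.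
Qed.

Ltac inv_type :=
  repeat match goal with
  | [ H : has_type _ _ (Ret (VVar _)) _ |- _ ] => inversion H; subst; clear H
  | [ H : has_type _ _ (Ret (VPair _ _)) _ |- _ ] => inversion H; subst; clear H
  | [ H : has_type _ _ (Ret (VLam _)) _ |- _ ] => inversion H; subst; clear H
  | [ H : has_type _ _ (Ret (VIn _ _)) _ |- _ ] => inversion H; subst; clear H
  | [ H : has_type _ _ (Ret (VTLam _)) _ |- _ ] => inversion H; subst; clear H
  | [ H : has_type _ _ Choose _ |- _ ] => inversion H; subst; clear H
  | [ H : has_type _ _ (Fst _) _ |- _ ] => inversion H; subst; clear H
  | [ H : has_type _ _ (Snd _) _ |- _ ] => inversion H; subst; clear H
  | [ H : has_type _ _ (App _ _) _ |- _ ] => inversion H; subst; clear H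
  | [ H : has_type _ _ (Case _ _) _ |- _ ] => inversion H; subst; clear H
  | [ H : has_type _ _ (TApp _ _) _ |- _ ] => inversion H; subst; clear H
  end.

Lemma preservation D G e e' t : has_type D G e t -> step e e' -> has_type D G e' t.
Proof.
  intros H Hs. revert t H. induction Hs; intros u Hu; pose proof (has_type_wf _ _ _ _ Hu) as [HG _];
    inv_type; eauto using has_type_inst, has_type_tyinst, has_type_num, ht_app.
Qed.

(** * Substitutions matter only on free variables *)

Lemma ty_subst_agree D t : wf_ty D t -> forall s s',
  (forall a, a < D -> s a = s' a) -> ty_subst s t = ty_subst s' t.
Proof.
  assert (Hup : forall D s s', (forall a, a < D -> s a = s' a) ->
                forall a, a < S D -> ty_up s a = ty_up s' a).
  { intros D0 s s' H [|a] Ha; simpl; [reflexivity|]. rewrite H; [reflexivity|lia]. }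
  induction 1; intros s s' Hs; simpl; auto; f_equal; eauto.
  apply map_ext_in. eauto.
Qed.

(** Typing stands in for a free-variable predicate: it bounds the type variables by [D] and the term
    variables by [length G]. *)
Lemma tm_subst_agree D G e t : has_type D G e t -> forall s s' g g',
  (forall a, a < D -> s a = s' a) -> (forall x, x < length G -> g x = g' x) ->
  tm_subst s g e = tm_subst s' g' e.
Proof.
  assert (Hty : forall D s s', (forall a, a < D -> s a = s' a) ->
                forall a, a < S D -> ty_up s a = ty_up s' a).
  { intros D0 s s' H [|a] Ha; simpl; [reflexivity|]. rewrite H; [reflexivity|lia]. }
  assert (Hval : forall n g g', (forall x, x < n -> g x = g' x) ->
                forall x, x < S n -> val_up g x = val_up g' x).
  { intros n g g' H [|x] Hx; simpl; [reflexivity|]. rewrite H; [reflexivity|lia]. }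
  induction 1; intros s s' g g' Hs Hg; simpl;
    (* For a value subterm the induction hypothesis equates two [Ret] terms; injectivity turns this
       into an equation of values. *)
    repeat match goal with
    | [ IH : forall s s' g g', _ -> _ -> tm_subst s g (Ret _) = _ |- _ ] =>
        specialize (IH s s' g g' Hs Hg); simpl in IH; injection IH as IH
    end; try congruence.
  - f_equal. apply Hg. apply nth_error_Some. congruence.
  - do 2 f_equal. apply IHhas_type; [exact Hs|]. simpl. eauto.
  - do 2 f_equal. apply IHhas_type; [eauto|].
    intros x Hx. unfold ctx_shift in Hx. rewrite length_map in Hx.
    unfold val_shift_ty. rewrite Hg; auto.
  - f_equal; [assumption|]. apply IHhas_type2; assumption.
  - f_equal; [assumption|]. apply map_ext_in. intros b Hb.
    apply In_nth_error in Hb as [j Hj].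
    (* Only branches with a matching summand are typed; the equal lengths exclude any other
       branch. *)
    destruct (nth_error ts j) as [u|] eqn:Eu.
    + eapply H3; simpl; eauto.
    + apply nth_error_None in Eu. rewrite <- H1 in Eu. apply nth_error_None in Eu. congruence.
  - f_equal; [assumption|]. apply ty_subst_agree with (1 := H0). exact Hs.
Qed.

Lemma tm_subst_closed e t s g : has_type 0 [] e t -> tm_subst s g e = e.
Proof.
  intros H. rewrite <- (tm_subst_id e) at 2.
  apply tm_subst_agree with (1 := H); simpl; intros; lia.
Qed.

Lemma val_subst_closed v t s g : has_type 0 [] (Ret v) t -> val_subst s g v = v.
Proof. intros H. apply (tm_subst_closed _ _ s g) in H. simpl in H. congruence. Qed.

(** * Evaluation contexts *)

Fixpoint ecomp (E F : ectx) : ectx :=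
  match E with
  | Hole => F
  | EApp v E => EApp v (ecomp E F)
  end.

Lemma plug_ecomp E F e : plug (ecomp E F) e = plug E (plug F e).
Proof. induction E; simpl; congruence. Qed.

Fixpoint ectx_subst (s : nat -> ty) (g : nat -> val) (E : ectx) : ectx :=
  match E with
  | Hole => Hole
  | EApp v E => EApp (val_subst s g v) (ectx_subst s g E)
  end.

Lemma plug_subst s g E e : tm_subst s g (plug E e) = plug (ectx_subst s g E) (tm_subst s g e).
Proof. induction E; simpl; congruence. Qed.

(** The typing judgement for stacks, from the type of the hole to that of the result. Unlike [Stk],
    it fixes one result type for all plugged terms, and the values in the stack may be open in
    [G]. *)
Fixpoint ectx_type (G : ctx) (E : ectx) (t t' : ty) : Prop :=
  match E with
  | Hole => t = t'
  | EApp v E => exists t1, ectx_type G E t t1 /\ has_type 0 G (Ret v) (TArr t1 t')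
  end.

Lemma plug_type G E e t t' :
  ectx_type G E t t' -> has_type 0 G e t -> has_type 0 G (plug E e) t'.
Proof.
  revert t'. induction E as [|v E IH]; simpl; intros t' HE He; [congruence|].
  destruct HE as (t1 & HE & Hv). apply ht_app with (1 := Hv). auto.
Qed.

Lemma plug_type_inv G E e t' :
  has_type 0 G (plug E e) t' -> exists t, has_type 0 G e t /\ ectx_type G E t t'.
Proof.
  revert t'. induction E as [|v E IH]; simpl; intros t' H; [eauto|].
  inversion H; subst. edestruct IH as (t & He & HE); eauto.
Qed.

Lemma ectx_type_Stk E t t' : ectx_type [] E t t' -> Stk t E.
Proof. intros H e He. exists t'. exact (plug_type _ _ _ _ _ H He). Qed.

Lemma ectx_type_weaken G E t t' : wf_ctx 0 G -> ectx_type [] E t t' -> ectx_type G E t t'.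
Proof.
  intros HG. revert t'. induction E as [|v E IH]; simpl; intros t' HE; [exact HE|].
  destruct HE as (t1 & HE & Hv). exists t1. split; [auto|].
  exact (has_type_weaken_end _ _ _ _ _ Hv HG).
Qed.

Lemma ectx_type_inst v t1 E t t' :
  Val t1 v -> ectx_type [t1] E t t' -> ectx_type [] (ectx_subst TVar (scons v VVar) E) t t'.
Proof.
  intros Hv. revert t'. induction E as [|u E IH]; simpl; intros t' HE; [exact HE|].
  destruct HE as (t2 & HE & Hu). exists t2. split; [auto|].
  exact (has_type_inst _ _ _ _ _ _ Hu Hv).
Qed.

Lemma ectx_subst_closed s g E t t' : ectx_type [] E t t' -> ectx_subst s g E = E.
Proof.
  revert t'. induction E as [|v E IH]; simpl; intros t' HE; [reflexivity|].
  destruct HE as (t1 & HE & Hv). f_equal; [|eauto]. exact (val_subst_closed _ _ _ _ Hv).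
Qed.

(** The self-application \x. case x of in_1 y => y x, typed with the recursive type mu b. (b -> a).
    It makes [diverge] an inhabitant of an arbitrary type variable a. *)
Definition self_app : val := VLam (Case (VVar 0) [App (VVar 0) (Ret (VVar 1))]).
Definition diverge : tm := App self_app (Ret (VIn 0 self_app)).

Lemma diverge_type : has_type 1 [] diverge (TVar 0).
Proof.
  assert (Hw : wf_ty 1 (TMu [TArr (TVar 0) (TVar 1)])).
  { constructor. intros t [<-|[]]. repeat constructor. }
  assert (Hself : has_type 1 [] self_app (TArr (TMu [TArr (TVar 0) (TVar 1)]) (TVar 0))).
  { constructor. apply ht_case with (ts := [TArr (TVar 0) (TVar 1)]).
    - constructor. lia.
    - constructor; [|reflexivity]. intros t [<-|[]]. exact Hw.
    - reflexivity.
    - intros [|[|j]] tj ej Ht He; simpl in *; try discriminate.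
      injection Ht as <-. injection He as <-.
      assert (wf_ctx 1 [ty_inst (TMu [TArr (TVar 0) (TVar 1)]) (TArr (TVar 0) (TVar 1));
                        TMu [TArr (TVar 0) (TVar 1)]]).
      { intros t [<-|[<-|[]]]; [|exact Hw]. apply wf_ty_inst; [exact Hw|]. repeat constructor. }
      eapply ht_app; constructor; auto; reflexivity. }
  apply ht_app with (1 := Hself). eapply ht_in; [exact Hw|reflexivity|]. exact Hself.
Qed.

(* [(\x. (\_. (\_. x[t]) c2) c1) (/\a. diverge)]: projecting from [x[1 * 1]] in [c1] and applying
   [x[1 -> 1]] in [c2] force the type of [x] to be [forall a. a], so the term has no type
   other than [t] although abstractions carry no annotations. *)
Definition typed_only (t : ty) : tm :=
  let c1 := App (VLam (Fst (VVar 0))) (TApp (VVar 0) (TProd TUnit TUnit)) in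
  let c2 := App (VLam (App (VVar 0) (Ret VUnit))) (TApp (VVar 1) (TArr TUnit TUnit)) in
  App (VLam (App (VLam (App (VLam (TApp (VVar 2) t)) c2)) c1)) (Ret (VTLam diverge)).

Lemma typed_only_type t : Typ t -> Tm t (typed_only t).
Proof.
  intros Ht.
  assert (Hall : wf_ty 0 (TAll (TVar 0))) by (repeat constructor).
  assert (Hx : forall G x u, wf_ctx 0 G -> nth_error G x = Some (TAll (TVar 0)) -> wf_ty 0 u ->
               has_type 0 G (TApp (VVar x) u) u).
  { intros G x u HG Hx Hu. change u with (ty_inst u (TVar 0)) at 2.
    constructor; [constructor|]; assumption. }
  assert (Hc : forall G, wf_ctx 0 G -> wf_ctx 0 (TUnit :: G)).
  { intros G HG. apply wf_ctx_cons; [constructor|exact HG]. }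
  assert (HG : wf_ctx 0 [TAll (TVar 0)]) by (apply wf_ctx_cons; [exact Hall|apply wf_ctx_nil]).
  unfold typed_only. eapply ht_app.
  2:{ constructor. exact diverge_type. }
  constructor. apply ht_app with (t1 := TUnit).
  - constructor. apply ht_app with (t1 := TUnit).
    + constructor. apply Hx; auto.
    + eapply ht_app; [|apply Hx; auto; repeat constructor].
      constructor. eapply ht_app; constructor; try reflexivity;
        apply wf_ctx_cons; auto; repeat constructor.
  - eapply ht_app; [|apply Hx; auto; repeat constructor].
    constructor. eapply ht_fst. constructor; [|reflexivity].
    apply wf_ctx_cons; auto; repeat constructor.
Qed.

Lemma typed_only_unique t u : Tm u (typed_only t) -> u = t.
Proof.
  unfold Tm, typed_only. intros H. inv_type. simpl in *.
  repeat match goal with [ K : Some _ = Some _ |- _ ] => injection K as K; subst end.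
  (* [T] is the body of the type of [x]. Its instance at 1 * 1 is a product and its instance at 1 ->
     1 is an arrow, which only the bound variable itself allows. *)
  match goal with [ |- ty_inst _ ?T = _ ] => destruct T as [[|a]| | | | |] end;
    unfold ty_inst in *; simpl in *; congruence.
Qed.

(** [Stk] lets the typing of the plugged term vary with the term. Plugging in a term whose only type
    is [t] pins the type of the hole, and inversion then yields a typing of the stack itself. *)
Lemma Stk_ectx_type t E : Typ t -> Stk t E -> exists t', ectx_type [] E t t'.
Proof.
  intros Ht HE. destruct (HE _ (typed_only_type t Ht)) as (t' & H).
  apply plug_type_inv in H as (u & Hu & HE'). apply typed_only_unique in Hu as ->. eauto.
Qed.

(** * Reduction *)

(** The would-be redexes that wait for the value of [x]. An application waits only once its argument
    is a value, since the argument is evaluated first. *)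
Inductive stuck (x : nat) : tm -> Prop :=
| stuck_fst : stuck x (Fst (VVar x))
| stuck_snd : stuck x (Snd (VVar x))
| stuck_app v : stuck x (App (VVar x) (Ret v))
| stuck_case bs : stuck x (Case (VVar x) bs)
| stuck_tapp t : stuck x (TApp (VVar x) t).

Lemma val_subst_num s g n : val_subst s g (num n) = num n.
Proof. induction n; simpl; congruence. Qed.

Lemma step_subst s g e e' : step e e' -> step (tm_subst s g e) (tm_subst s g e').
Proof.
  induction 1; simpl; rewrite ?tm_subst_inst, ?tm_subst_tyinst, ?val_subst_num;
    constructor; auto.
  rewrite nth_error_map, H. reflexivity.
Qed.

(** Substituting values creates a new redex only where a variable stands in eliminated position;
    every other redex of the instance is already visible in [e]. *)
Lemma step_subst_inv s g e : forall e1, step (tm_subst s g e) e1 ->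
  (exists e', step e e' /\ e1 = tm_subst s g e') \/
  (exists E x r, e = plug E r /\ stuck x r).
Proof.
  induction e as [v| |v|v|v e IH|v bs|v t]; simpl; intros e1 H.
  - inversion H.
  - inversion H; subst. left. exists (num n). simpl. rewrite val_subst_num. split; constructor.
  - destruct v; simpl in H; inversion H; subst.
    + right. exists Hole. eexists _, _. split; [reflexivity|constructor].
    + left. eexists. split; [constructor|reflexivity].
  - destruct v; simpl in H; inversion H; subst.
    + right. exists Hole. eexists _, _. split; [reflexivity|constructor].
    + left. eexists. split; [constructor|reflexivity].
  (* Either the argument is already a value, or the step takes place inside it: substitution turns
     no proper term into a value. *)
  - assert (Happ : (exists e0, e = Ret e0) \/ (exists e2, step (tm_subst s g e) e2 /\
                    e1 = App (val_subst s g v) e2)).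
    { inversion H; subst; eauto.
      destruct e; simpl in *; try discriminate. eauto. }
    destruct Happ as [[u ->]|(e2 & H2 & ->)].
    + destruct v; simpl in H; inversion H; subst;
        try match goal with [ K : step (Ret _) _ |- _ ] => inversion K end.
      * right. exists Hole. eexists _, _. split; [reflexivity|constructor].
      * left. eexists. split; [constructor|]. symmetry. apply tm_subst_inst.
    + destruct (IH _ H2) as [(e' & He & ->)|(E & x & r & -> & Hr)].
      * left. exists (App v e'). split; [constructor; exact He|reflexivity].
      * right. exists (EApp v E), x, r. auto.
  - destruct v; simpl in H; inversion H; subst.
    + right. exists Hole. eexists _, _. split; [reflexivity|constructor].
    + match goal with [ K : nth_error _ _ = Some _ |- _ ] => rename K into Hj end.
      rewrite nth_error_map in Hj. destruct (nth_error bs j) as [b|] eqn:E; [|discriminate].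
      injection Hj as <-. left. exists (tm_inst v b).
      split; [constructor; exact E|]. symmetry. apply tm_subst_inst.
  - destruct v; simpl in H; inversion H; subst.
    + right. exists Hole. eexists _, _. split; [reflexivity|constructor].
    + left. eexists. split; [constructor|]. symmetry. apply tm_subst_tyinst.
Qed.

Lemma stuck_type x r T t : stuck x r -> has_type 0 [T] r t -> has_type 0 [T] (VVar x) T /\ x = 0.
Proof.
  intros Hr H.
  assert (exists u, has_type 0 [T] (VVar x) u) as [u Hu].
  { destruct Hr; inversion H; subst; eauto. }
  inversion Hu; subst. destruct x as [|[|x]]; simpl in *; try discriminate.
  split; [congruence|reflexivity].
Qed.

(** Uniqueness is what makes the observables invariant: after a mere step, may-convergence of [e]
    could be lost in [e1], and must-convergence of [e1] need not carry back to [e]. *)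
Definition det_step (e e1 : tm) : Prop := step e e1 /\ forall e2, step e e2 -> e2 = e1.

Lemma det_step_beta e (v : val) : det_step (App (VLam e) v) (tm_inst v e).
Proof.
  split; [constructor|]. intros e2 H. inversion H; subst; [reflexivity|].
  match goal with [ K : step (Ret _) _ |- _ ] => inversion K end.
Qed.

Lemma det_step_tbeta e t : det_step (TApp (VTLam e) t) (tm_tyinst t e).
Proof. split; [constructor|]. intros e2 H. inversion H. reflexivity. Qed.

Lemma det_step_case j v bs e :
  nth_error bs j = Some e -> det_step (Case (VIn j v) bs) (tm_inst v e).
Proof.
  intros Hj. split; [constructor; exact Hj|]. intros e2 H. inversion H; subst. congruence.
Qed.

Lemma det_step_plug E e e1 : det_step e e1 -> det_step (plug E e) (plug E e1).
Proof.
  intros He. induction E as [|v E [IH1 IH2]]; simpl; [exact He|].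
  split; [constructor; exact IH1|]. intros e2 H. inversion H; subst.
  (* A beta step at this application would require [plug E e] to be a value, yet it has a step. *)
  - match goal with [ K : Ret _ = plug E e |- _ ] => rewrite <- K in IH1 end. inversion IH1.
  - f_equal. auto.
Qed.

(* [obs_sim] lets a deterministic step of [a] be answered by a [b] that need not step to the
   simulating term [b1], as long as [obs] transfers from [b1] to [b]; this is where a CIU
   hypothesis enters a simulation. *)
Record observable (obs : tm -> Prop) : Prop := {
  obs_det : forall e e1, det_step e e1 -> obs e <-> obs e1;
  obs_sim : forall S : tm -> tm -> Prop,
    (forall a b, S a b ->
      ((forall v : val, a = Ret v -> exists v' : val, b = Ret v') /\
       (forall a1, step a a1 -> exists b1, step b b1 /\ S a1 b1) /\
       (forall b1, step b b1 -> exists a1, step a a1 /\ S a1 b1)) \/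
      (exists a1 b1, det_step a a1 /\ S a1 b1 /\ (obs b1 -> obs b))) ->
    forall a b, S a b -> obs a -> obs b
}.

Lemma may_conv_step e e1 : step e e1 -> may_conv e1 -> may_conv e.
Proof. intros H [v Hv]. exists v. apply rt_trans with e1; [apply rt_step; exact H|exact Hv]. Qed.

Lemma may_conv_observable : observable may_conv.
Proof.
  split.
  - intros e e1 [H Huniq]. split; [|apply may_conv_step; exact H].
    intros [v Hv]. apply clos_rt_rt1n in Hv. inversion Hv; subst; [inversion H|].
    match goal with [ K : step e _ |- _ ] => apply Huniq in K as -> end.
    exists v. apply clos_rt1n_rt. assumption.
  (* Induction on the convergent run of [a]. A matched step is copied by [b]; a deterministic step
     must be the first step of the run, so the hypothesis gives convergence of [b1], which transfers
     to [b]. *)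
  - intros S HS a b Hab [v Hv]. apply clos_rt_rt1n in Hv.
    remember (Ret v) as u eqn:Eu. revert b Hab.
    induction Hv as [a|a a1 u Ha Hv IH]; intros b Hab;
      destruct (HS _ _ Hab) as [(Hval & Hforth & _)|(a2 & b1 & [Ha2 Huniq] & Hab1 & Hb)].
    + destruct (Hval v Eu) as [v' ->]. exists v'. apply rt_refl.
    + subst. inversion Ha2.
    + destruct (Hforth _ Ha) as (b1 & Hb & Hab1). apply may_conv_step with (1 := Hb). auto.
    + apply Hb. apply IH; [exact Eu|]. rewrite (Huniq _ Ha). exact Hab1.
Qed.

Lemma may_div_step e e1 : step e e1 -> may_div e1 -> may_div e.
Proof.
  intros H (f & <- & Hf). exists (fun i => match i with 0 => e | S i => f i end).
  split; [reflexivity|]. intros [|i]; auto.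
Qed.

Lemma may_div_inv e : may_div e -> exists e1, step e e1 /\ may_div e1.
Proof.
  intros (f & <- & Hf). exists (f 1). split; [apply Hf|].
  exists (fun i => f (S i)). split; [reflexivity|]. intros i. apply Hf.
Qed.

Lemma may_div_coind (P : tm -> Prop) :
  (forall e, P e -> exists e1, step e e1 /\ P e1) -> forall e, P e -> may_div e.
Proof.
  intros HP e He.
  assert (Hnext : forall x : {e | P e}, exists y : {e | P e}, step (proj1_sig x) (proj1_sig y)).
  { intros [e0 H0]. destruct (HP _ H0) as (e1 & Hs & H1). exists (exist _ e1 H1). exact Hs. }
  (* Choice on the subtype of [P] gives a successor function; its iterates from [e] form the
     infinite run. *)
  apply functional_choice in Hnext as [next Hnext].
  exists (fun i => proj1_sig (Nat.iter i next (exist _ e He))). split; [reflexivity|].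
  intros i. apply Hnext.
Qed.

Lemma must_conv_observable : observable must_conv.
Proof.
  split.
  - intros e e1 [H Huniq]. unfold must_conv. split; intros Hn Hd; apply Hn.
    + exact (may_div_step _ _ H Hd).
    + destruct (may_div_inv _ Hd) as (e2 & He & Hd2). apply Huniq in He as ->. exact Hd2.
  (* By contraposition: a divergent [b] makes every related [a] diverge. In both alternatives of the
     simulation [a] takes a real step, so the run of [a] is infinite even where [b] stands still. *)
  - intros S HS a b Hab Ha Hb. apply Ha.
    apply may_div_coind with (P := fun a => exists b, S a b /\ may_div b); [|eauto].
    clear a b Hab Ha Hb. intros a (b & Hab & Hb).
    destruct (HS _ _ Hab) as [(_ & _ & Hback)|(a1 & b1 & [Ha _] & Hab1 & Hobs)].
    + destruct (may_div_inv _ Hb) as (b1 & Hb1 & Hd). destruct (Hback _ Hb1) as (a1 & Ha & Hab1).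
      eauto.
    + exists a1. split; [exact Ha|]. exists b1. split; [exact Hab1|].
      (* If [b1] did not diverge, must-convergence would transfer from [b1] to [b], which
         diverges. *)
      apply NNPP. intros Hn. exact (Hobs Hn Hb).
Qed.

(** * CIU approximation of closed terms *)

Definition ciu_closed (obs : tm -> Prop) (e e' : tm) (t : ty) : Prop :=
  forall E, Stk t E -> obs (plug E e) -> obs (plug E e').

Lemma ciu_closed_trans obs e1 e2 e3 t :
  ciu_closed obs e1 e2 t -> ciu_closed obs e2 e3 t -> ciu_closed obs e1 e3 t.
Proof. intros H1 H2 E HE H. auto. Qed.

Lemma ciu_closed_det obs (Hobs : observable obs) e e' e1 e1' t :
  det_step e e1 -> det_step e' e1' ->
  ciu_closed obs e e' t <-> ciu_closed obs e1 e1' t.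
Proof.
  intros He He'.
  split; intros H E HE Ho; specialize (H E HE);
    rewrite (obs_det _ Hobs _ _ (det_step_plug E _ _ He)),
            (obs_det _ Hobs _ _ (det_step_plug E _ _ He')) in *; auto.
Qed.

Lemma ciu_closed_ectx obs F e e' t t' :
  ectx_type [] F t t' -> ciu_closed obs e e' t -> ciu_closed obs (plug F e) (plug F e') t'.
Proof.
  intros HF H E HE. rewrite <- !plug_ecomp. apply H.
  intros u Hu. rewrite plug_ecomp. apply HE. exact (plug_type _ _ _ _ _ HF Hu).
Qed.

(** [C[w]] is the deterministic reduct of [w] plugged into the stack (\x. C) []. Hence a value
    position anywhere in a term can be treated like the hole of a stack. *)
Lemma ciu_closed_inst obs (Hobs : observable obs) C (w w' : val) t t' :
  has_type 0 [t] C t' -> ciu_closed obs w w' t ->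
  ciu_closed obs (tm_inst w C) (tm_inst w' C) t'.
Proof.
  intros HC H.
  apply (ciu_closed_det obs Hobs _ _ _ _ _ (det_step_beta C w) (det_step_beta C w')).
  apply (ciu_closed_ectx obs (EApp (VLam C) Hole)) with (t := t); [|exact H].
  exists t. split; [reflexivity|]. constructor. exact HC.
Qed.

Lemma has_type_closed_weaken G e t : wf_ctx 0 G -> has_type 0 [] e t -> has_type 0 G e t.
Proof. intros HG H. exact (has_type_weaken_end _ _ _ _ _ H HG). Qed.

Lemma wf_ctx_singleton t : Typ t -> wf_ctx 0 [t].
Proof. intros Ht. apply wf_ctx_cons; [exact Ht|apply wf_ctx_nil]. Qed.

(* Run [C[w]] and [C[w']] in lockstep for all open terms [C]: reductions of [C] itself are
   shared, and when [C] is stuck on its variable the hypothesis provides a term [r1] into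
   which the stuck redex reduces on the left, and which approximates it on the right. *)
Lemma ciu_closed_value obs (Hobs : observable obs) T (w w' : val) :
  Typ T -> Val T w -> Val T w' ->
  (forall r t, stuck 0 r -> has_type 0 [T] r t ->
    exists r1, has_type 0 [T] r1 t /\ det_step (tm_inst w r) (tm_inst w r1) /\
      ciu_closed obs (tm_inst w' r1) (tm_inst w' r) t) ->
  ciu_closed obs w w' T.
Proof.
  intros HT Hw Hw' Hred E HE Ho.
  apply (Stk_ectx_type _ _ HT) in HE as [t' HE].
  apply (obs_sim _ Hobs) with
    (S := fun a b => exists C t, has_type 0 [T] C t /\ a = tm_inst w C /\ b = tm_inst w' C)
    (a := plug E w); [|exists (plug E (VVar 0)), t'|exact Ho].
  - clear E t' HE Ho. intros a b (C & t & HC & -> & ->).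
    destruct (classic (exists E x r, C = plug E r /\ stuck x r)) as [(E & x & r & -> & Hr)|Hns].
    + right. apply plug_type_inv in HC as (u & Hru & HE).
      pose proof (stuck_type _ _ _ _ Hr Hru) as [_ ->].
      destruct (Hred _ _ Hr Hru) as (r1 & Hr1 & Hdet & Hciu).
      unfold tm_inst, tm_valsubst. rewrite !plug_subst.
      eexists _, _. split; [apply det_step_plug; exact Hdet|]. split.
      * exists (plug E r1), t. unfold tm_inst, tm_valsubst. rewrite !plug_subst.
        split; [exact (plug_type _ _ _ _ _ HE Hr1)|auto].
      (* On the right the redex sits in the stack instantiated with [w']; the CIU hypothesis at that
         stack is the transfer asked for by [obs_sim]. *)
      * apply Hciu. exact (ectx_type_Stk _ _ _ (ectx_type_inst _ _ _ _ _ Hw' HE)).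
    + left. split; [|split].
      * intros v Hv. destruct C; try discriminate. eexists. reflexivity.
      * intros a1 Ha. destruct (step_subst_inv _ _ _ _ Ha) as [(C1 & HC1 & ->)|]; [|contradiction].
        exists (tm_inst w' C1). split; [apply step_subst; exact HC1|].
        exists C1, t. eauto using preservation.
      * intros b1 Hb. destruct (step_subst_inv _ _ _ _ Hb) as [(C1 & HC1 & ->)|]; [|contradiction].
        exists (tm_inst w C1). split; [apply step_subst; exact HC1|].
        exists C1, t. eauto using preservation.
  - unfold tm_inst, tm_valsubst. rewrite !plug_subst, !(ectx_subst_closed _ _ _ _ _ HE).
    split; [|auto]. pose proof (wf_ctx_singleton _ HT) as HG.
    apply plug_type with (t := T); [exact (ectx_type_weaken _ _ _ _ HG HE)|].
    constructor; [exact HG|reflexivity].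
Qed.

(** At arrow type the only stuck redex is [x v], where [v] may mention [x]. The left side unfolds to
    [e[v]]; on the right, the hypothesis is used at the closed value obtained from [v] by
    substituting the right abstraction. *)
Lemma ciu_closed_lam obs (Hobs : observable obs) e e' t1 t2 :
  has_type 0 [t1] e t2 -> has_type 0 [t1] e' t2 ->
  (forall v, Val t1 v -> ciu_closed obs (tm_inst v e) (tm_inst v e') t2) ->
  ciu_closed obs (VLam e) (VLam e') (TArr t1 t2).
Proof.
  intros He He' H.
  assert (HT : Typ (TArr t1 t2)) by (apply (has_type_wf 0 [] (VLam e)); constructor; exact He).
  apply (ciu_closed_value obs Hobs); [exact HT|constructor; assumption..|].
  intros r t Hr Hrt. destruct Hr as [| |v|bs|s]; inv_type; simpl in *;
    try discriminate.
  match goal with [ K : Some _ = Some _ |- _ ] => injection K as <- <- end.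
  match goal with [ K : has_type 0 _ (Ret v) _ |- _ ] => rename K into Hv end.
  set (w := val_subst TVar (scons (VLam e) VVar) v).
  set (w' := val_subst TVar (scons (VLam e') VVar) v).
  (* The only free variable of [e] is its own parameter, so a further substitution reaches only the
     argument. *)
  assert (Hinst : forall u g, tm_subst TVar g (tm_inst u e) = tm_inst (val_subst TVar g u) e).
  { intros u g. rewrite tm_subst_inst, tm_inst_subst. unfold tm_inst, tm_valsubst.
    apply tm_subst_agree with (1 := He); [reflexivity|].
    intros [|x] Hx; simpl in *; [reflexivity|lia]. }
  (* The simulating term has the left body [e] on both sides; passing from [e] to [e'] is left to
     the hypothesis. *)
  exists (tm_inst v e). split; [|split].
  - apply has_type_inst with (t1 := t1); [|exact Hv].
    apply (has_type_weaken_end 0 [t1] [TArr t1 t2]); [exact He|exact (wf_ctx_singleton _ HT)].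
  - unfold tm_inst at 2, tm_valsubst. rewrite Hinst. apply det_step_beta.
  - unfold tm_inst at 1, tm_valsubst. rewrite Hinst.
    intros E HE Ho. apply (obs_det _ Hobs _ _ (det_step_plug E _ _ (det_step_beta e' w'))).
    apply H; [|exact HE|exact Ho].
    apply (has_type_inst 0 [] (VLam e') (Ret v) _ _ Hv). constructor. exact He'.
Qed.

(** Here the only stuck redex is a type application [x[s]], and its unfolding [e[s]] is closed, so
    it is the same term on both sides of the simulation. *)
Lemma ciu_closed_tlam obs (Hobs : observable obs) e e' t :
  has_type 1 [] e t -> has_type 1 [] e' t ->
  (forall s, Typ s -> ciu_closed obs (tm_tyinst s e) (tm_tyinst s e') (ty_inst s t)) ->
  ciu_closed obs (VTLam e) (VTLam e') (TAll t).
Proof.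
  intros He He' H.
  assert (HT : Typ (TAll t)) by (apply (has_type_wf 0 [] (VTLam e)); constructor; exact He).
  apply (ciu_closed_value obs Hobs); [exact HT|constructor; assumption..|].
  intros r u Hr Hrt. destruct Hr as [| |v|bs|s]; inv_type; simpl in *;
    try discriminate.
  match goal with [ K : Some _ = Some _ |- _ ] => injection K as <- end.
  match goal with [ K : wf_ty 0 s |- _ ] => rename K into Hs end.
  assert (Hse : has_type 0 [] (tm_tyinst s e) (ty_inst s t)).
  { apply has_type_tyinst; [exact He|apply wf_ctx_nil|exact Hs]. }
  exists (tm_tyinst s e). unfold tm_inst, tm_valsubst.
  rewrite !(tm_subst_closed _ _ _ _ Hse). simpl. rewrite !ty_subst_id. split; [|split].
  - apply has_type_closed_weaken; [exact (wf_ctx_singleton _ HT)|exact Hse].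
  - apply det_step_tbeta.
  - intros E HE Ho. apply (obs_det _ Hobs _ _ (det_step_plug E _ _ (det_step_tbeta e' s))).
    apply H; assumption.
Qed.

(** * Compatibility of closed CIU approximation with the other term formers *)

Lemma ciu_closed_pair obs (Hobs : observable obs) (v1 v1' v2 v2' : val) t1 t2 :
  Val t1 v1' -> Val t2 v2 -> ciu_closed obs v1 v1' t1 -> ciu_closed obs v2 v2' t2 ->
  ciu_closed obs (VPair v1 v2) (VPair v1' v2') (TProd t1 t2).
Proof.
  intros Hv1' Hv2 H1 H2.
  pose proof (wf_ctx_singleton _ (proj2 (has_type_wf _ _ _ _ Hv1'))) as HG1.
  pose proof (wf_ctx_singleton _ (proj2 (has_type_wf _ _ _ _ Hv2))) as HG2.
  apply ciu_closed_trans with (e2 := VPair v1' v2).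
  - apply (ciu_closed_inst obs Hobs (VPair (VVar 0) v2)) with (t' := TProd t1 t2) in H1.
    + unfold tm_inst, tm_valsubst in H1. simpl in H1.
      rewrite !(val_subst_closed _ _ _ _ Hv2) in H1. exact H1.
    + constructor; [constructor; [exact HG1|reflexivity]|].
      apply has_type_closed_weaken; assumption.
  - apply (ciu_closed_inst obs Hobs (VPair v1' (VVar 0))) with (t' := TProd t1 t2) in H2.
    + unfold tm_inst, tm_valsubst in H2. simpl in H2.
      rewrite !(val_subst_closed _ _ _ _ Hv1') in H2. exact H2.
    + constructor; [|constructor; [exact HG2|reflexivity]].
      apply has_type_closed_weaken; assumption.
Qed.

Lemma ciu_closed_app obs (Hobs : observable obs) (v v' : val) e e' t1 t2 :
  Val (TArr t1 t2) v -> Tm t1 e' ->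
  ciu_closed obs v v' (TArr t1 t2) -> ciu_closed obs e e' t1 ->
  ciu_closed obs (App v e) (App v' e') t2.
Proof.
  intros Hv He' H1 H2.
  pose proof (wf_ctx_singleton _ (proj2 (has_type_wf _ _ _ _ Hv))) as HG.
  apply ciu_closed_trans with (e2 := App v e').
  - apply (ciu_closed_ectx obs (EApp v Hole)) with (t := t1); [|exact H2].
    exists t1. split; [reflexivity|exact Hv].
  - apply (ciu_closed_inst obs Hobs (App (VVar 0) e')) with (t' := t2) in H1.
    + unfold tm_inst, tm_valsubst in H1. simpl in H1.
      rewrite !(tm_subst_closed _ _ _ _ He') in H1. exact H1.
    + apply ht_app with (t1 := t1); [constructor; [exact HG|reflexivity]|].
      apply has_type_closed_weaken; assumption.
Qed.

Lemma Val_TMu_inv ts v : Val (TMu ts) v -> exists j t v0,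
  v = VIn j v0 /\ nth_error ts j = Some t /\ Val (ty_inst (TMu ts) t) v0.
Proof.
  intros H. inversion H; subst; [|eauto 6].
  match goal with [ K : nth_error [] ?x = _ |- _ ] => destruct x; discriminate end.
Qed.

(** First the scrutinee is exchanged with the branches fixed. Then the closed [v'] is an injection,
    so both case analyses take a deterministic step into branches related by hypothesis. *)
Lemma ciu_closed_case obs (Hobs : observable obs) (v v' : val) bs bs' ts t :
  Typ t -> Val (TMu ts) v' -> ciu_closed obs v v' (TMu ts) ->
  length bs = length ts -> length bs' = length ts ->
  (forall j tj ej, nth_error ts j = Some tj -> nth_error bs j = Some ej ->
     has_type 0 [ty_inst (TMu ts) tj] ej t) ->
  (forall j tj ej ej' v0, nth_error ts j = Some tj ->
     nth_error bs j = Some ej -> nth_error bs' j = Some ej' ->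
     Val (ty_inst (TMu ts) tj) v0 -> ciu_closed obs (tm_inst v0 ej) (tm_inst v0 ej') t) ->
  ciu_closed obs (Case v bs) (Case v' bs') t.
Proof.
  intros Ht Hv' Hv Hlen Hlen' Hbs H.
  pose proof (wf_ctx_singleton _ (proj2 (has_type_wf _ _ _ _ Hv'))) as HG.
  apply ciu_closed_trans with (e2 := Case v' bs).
  - apply (ciu_closed_inst obs Hobs (Case (VVar 0) bs)) with (t' := t) in Hv.
    (* Each branch has at most its own parameter free, so instantiating the scrutinee variable
       leaves it unchanged. *)
    + assert (Hmap : forall w, tm_inst w (Case (VVar 0) bs) = Case w bs).
      { intros w. unfold tm_inst, tm_valsubst. simpl. f_equal.
        rewrite <- (map_id bs) at 2. apply map_ext_in. intros b Hb.
        apply In_nth_error in Hb as [j Hj].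
        destruct (nth_error ts j) as [u|] eqn:Eu.
        - rewrite <- (tm_subst_id b) at 2.
          apply tm_subst_agree with (1 := Hbs _ _ _ Eu Hj); [reflexivity|].
          intros [|x] Hx; simpl in *; [reflexivity|lia].
        - apply nth_error_None in Eu. rewrite <- Hlen in Eu. apply nth_error_None in Eu.
          congruence. }
      rewrite !Hmap in Hv. exact Hv.
    + apply ht_case with (ts := ts); [exact Ht|constructor; [exact HG|reflexivity]|exact Hlen|].
      intros j tj ej Htj Hej.
      exact (has_type_weaken_end 0 [_] _ _ _ (Hbs _ _ _ Htj Hej) HG).
  - apply Val_TMu_inv in Hv' as (j & tj & v0 & -> & Htj & Hv0).
    assert (Hnth : forall l : list tm, length l = length ts -> exists b, nth_error l j = Some b).
    { intros l Hl. destruct (nth_error l j) eqn:El; [eauto|].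
      apply nth_error_None in El. rewrite Hl in El. apply nth_error_None in El. congruence. }
    destruct (Hnth _ Hlen) as [b Hb], (Hnth _ Hlen') as [b' Hb'].
    apply (ciu_closed_det obs Hobs _ _ _ _ _
             (det_step_case _ v0 _ _ Hb) (det_step_case _ v0 _ _ Hb')).
    eauto.
Qed.

Lemma ciu_closed_in obs (Hobs : observable obs) j (v v' : val) ts t :
  Typ (TMu ts) -> nth_error ts j = Some t -> Val (ty_inst (TMu ts) t) v ->
  ciu_closed obs v v' (ty_inst (TMu ts) t) -> ciu_closed obs (VIn j v) (VIn j v') (TMu ts).
Proof.
  intros Hts Hj Hv H.
  pose proof (wf_ctx_singleton _ (proj2 (has_type_wf _ _ _ _ Hv))) as HG.
  apply (ciu_closed_inst obs Hobs (VIn j (VVar 0))) with (t' := TMu ts) in H; [exact H|].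
  apply ht_in with (t := t); [assumption..|]. constructor; [exact HG|reflexivity].
Qed.

Lemma ciu_closed_fst obs (Hobs : observable obs) (v v' : val) t1 t2 :
  Val (TProd t1 t2) v -> ciu_closed obs v v' (TProd t1 t2) -> ciu_closed obs (Fst v) (Fst v') t1.
Proof.
  intros Hv H.
  pose proof (wf_ctx_singleton _ (proj2 (has_type_wf _ _ _ _ Hv))) as HG.
  apply (ciu_closed_inst obs Hobs (Fst (VVar 0))) with (t' := t1) in H; [exact H|].
  apply ht_fst with (t2 := t2). constructor; [exact HG|reflexivity].
Qed.

Lemma ciu_closed_snd obs (Hobs : observable obs) (v v' : val) t1 t2 :
  Val (TProd t1 t2) v -> ciu_closed obs v v' (TProd t1 t2) -> ciu_closed obs (Snd v) (Snd v') t2.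
Proof.
  intros Hv H.
  pose proof (wf_ctx_singleton _ (proj2 (has_type_wf _ _ _ _ Hv))) as HG.
  apply (ciu_closed_inst obs Hobs (Snd (VVar 0))) with (t' := t2) in H; [exact H|].
  apply ht_snd with (t1 := t1). constructor; [exact HG|reflexivity].
Qed.

Lemma ciu_closed_tapp obs (Hobs : observable obs) (v v' : val) t s :
  Val (TAll t) v -> Typ s -> ciu_closed obs v v' (TAll t) ->
  ciu_closed obs (TApp v s) (TApp v' s) (ty_inst s t).
Proof.
  intros Hv Hs H.
  pose proof (wf_ctx_singleton _ (proj2 (has_type_wf _ _ _ _ Hv))) as HG.
  apply (ciu_closed_inst obs Hobs (TApp (VVar 0) s)) with (t' := ty_inst s t) in H.
  - unfold tm_inst, tm_valsubst in H. simpl in H. rewrite ty_subst_id in H. exact H.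
  - constructor; [constructor; [exact HG|reflexivity]|exact Hs].
Qed.

(** * CIU approximation of open terms *)

Lemma ciu_approx_iff obs D G e e' t :
  ciu_approx obs D G e e' t <->
  has_type D G e t /\ has_type D G e' t /\
  forall d, TypSubst D d -> forall g, Subst (map (ty_subst d) G) g ->
    ciu_closed obs (tm_subst d g e) (tm_subst d g e') (ty_subst d t).
Proof.
  split; intros (He & He' & H); split; [exact He| |exact He|]; (split; [exact He'|]);
    intros d Hd g Hg E HE Ho; specialize (H d Hd g Hg E HE); rewrite !tm_val_ty_subst in *; auto.
Qed.

Lemma has_type_close D G e t d g :
  has_type D G e t -> TypSubst D d -> Subst (map (ty_subst d) G) g ->
  has_type 0 [] (tm_subst d g e) (ty_subst d t).
Proof.
  intros He Hd Hg. apply has_type_subst with (1 := He); [exact Hd|apply wf_ctx_nil|].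
  intros x u Hx. apply Hg. rewrite nth_error_map, Hx. reflexivity.
Qed.

(** The closed abstraction is typed first and its typing inverted; this avoids substituting under
    the binder directly. *)
Lemma has_type_close_lam D G e t1 t2 d g :
  has_type D (t1 :: G) e t2 -> TypSubst D d -> Subst (map (ty_subst d) G) g ->
  has_type 0 [ty_subst d t1] (tm_subst d (val_up g) e) (ty_subst d t2).
Proof.
  intros He Hd Hg. apply ht_lam in He.
  pose proof (has_type_close _ _ _ _ _ _ He Hd Hg) as H. inversion H; subst. assumption.
Qed.

Lemma has_type_close_tlam D G e t d g :
  has_type (S D) (ctx_shift G) e t -> TypSubst D d -> Subst (map (ty_subst d) G) g ->
  has_type 1 [] (tm_subst (ty_up d) (val_shift_ty g) e) (ty_subst (ty_up d) t).
Proof.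
  intros He Hd Hg. apply ht_tlam in He.
  pose proof (has_type_close _ _ _ _ _ _ He Hd Hg) as H. inversion H; subst. assumption.
Qed.

Lemma scons_ty_inst s d t : ty_inst s (ty_subst (ty_up d) t) = ty_subst (scons s d) t.
Proof.
  unfold ty_inst. rewrite ty_subst_subst. f_equal. fun_ext. rewrite ty_subst_ren. apply ty_subst_id.
Qed.

Lemma TypSubst_scons D t d : Typ t -> TypSubst D d -> TypSubst (S D) (scons t d).
Proof. intros Ht Hd [|a] Ha; simpl; [exact Ht|]. apply Hd. lia. Qed.

Lemma Subst_scons v t G g : Val t v -> Subst G g -> Subst (t :: G) (scons v g).
Proof. intros Hv Hg [|x] u Hx; simpl in *; [congruence|auto]. Qed.

Lemma ciu_approx_compatible obs : observable obs -> compatible (ciu_approx obs).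
Proof.
  intros Hobs.
  split; intros; rewrite ?ciu_approx_iff in *;
    repeat match goal with [ H : _ /\ _ |- _ ] => destruct H end;
    (* Variables, unit and choice: both sides are the same term. *)
    try (split; [|split]; [constructor; assumption..|]; intros d Hd g Hg E HE Ho; exact Ho);
    try (split; [|split]; [econstructor; eassumption..|]; intros d Hd g Hg; simpl).
  - apply (ciu_closed_pair obs Hobs).
    + apply (has_type_close D G (Ret v1')); assumption.
    + apply (has_type_close D G (Ret v2)); assumption.
    + apply (H4 d Hd g Hg).
    + apply (H2 d Hd g Hg).
  - apply (ciu_closed_lam obs Hobs); eauto using has_type_close_lam.
    intros v Hv. rewrite !tm_inst_subst. apply (H1 d Hd).
    apply Subst_scons; assumption.
  - apply (ciu_closed_in obs Hobs) with (t := ty_subst (ty_up d) t).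
    + apply (wf_ty_subst D (TMu ts)); assumption.
    + rewrite nth_error_map, H0. reflexivity.
    + change (TMu (map (ty_subst (ty_up d)) ts)) with (ty_subst d (TMu ts)).
      rewrite <- ty_subst_inst. apply (has_type_close D G (Ret v)); assumption.
    + change (TMu (map (ty_subst (ty_up d)) ts)) with (ty_subst d (TMu ts)).
      rewrite <- ty_subst_inst. apply (H3 d Hd g Hg).
  - apply (ciu_closed_tlam obs Hobs); eauto using has_type_close_tlam.
    intros s Hs. rewrite !tm_tyinst_subst, scons_ty_inst. apply H1.
    + apply TypSubst_scons; assumption.
    + rewrite ctx_shift_subst. exact Hg.
  - apply (ciu_closed_fst obs Hobs) with (t2 := ty_subst d t2).
    + apply (has_type_close D G (Ret v) (TProd t1 t2)); assumption.
    + apply (H1 d Hd g Hg).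
  - apply (ciu_closed_snd obs Hobs) with (t1 := ty_subst d t1).
    + apply (has_type_close D G (Ret v) (TProd t1 t2)); assumption.
    + apply (H1 d Hd g Hg).
  - apply (ciu_closed_app obs Hobs) with (t1 := ty_subst d t1).
    + apply (has_type_close D G (Ret v) (TArr t1 t2)); assumption.
    + apply (has_type_close D G e'); assumption.
    + apply (H4 d Hd g Hg).
    + apply (H2 d Hd g Hg).
  (* The hypothesis speaks of pairs of branches; as both lists are as long as [ts], every branch has
     a partner and so is typed. *)
  - assert (Hbs : forall j tj ej, nth_error ts j = Some tj -> nth_error bs j = Some ej ->
                  has_type D (ty_inst (TMu ts) tj :: G) ej t).
    { intros j tj ej Htj Hej. destruct (nth_error bs' j) as [ej'|] eqn:E.
      - specialize (H3 j tj ej ej' Htj Hej E). rewrite ciu_approx_iff in H3. apply H3.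
      - apply nth_error_None in E. rewrite H2, <- H1 in E. apply nth_error_None in E. congruence. }
    assert (Hbs' : forall j tj ej, nth_error ts j = Some tj -> nth_error bs' j = Some ej ->
                  has_type D (ty_inst (TMu ts) tj :: G) ej t).
    { intros j tj ej' Htj Hej'. destruct (nth_error bs j) as [ej|] eqn:E.
      - specialize (H3 j tj ej ej' Htj E Hej'). rewrite ciu_approx_iff in H3. apply H3.
      - apply nth_error_None in E. rewrite H1, <- H2 in E. apply nth_error_None in E. congruence. }
    split; [|split]; [eapply ht_case; eassumption..|]. intros d Hd g Hg. simpl.
    assert (Hinst : forall u, ty_inst (TMu (map (ty_subst (ty_up d)) ts)) (ty_subst (ty_up d) u)
                              = ty_subst d (ty_inst (TMu ts) u)).
    { intros u. symmetry. apply (ty_subst_inst d (TMu ts)). }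
    apply (ciu_closed_case obs Hobs) with (ts := map (ty_subst (ty_up d)) ts);
      rewrite ?length_map; auto.
    + apply wf_ty_subst with (1 := H). exact Hd.
    + apply (has_type_close D G (Ret v') (TMu ts)); assumption.
    + apply (H5 d Hd g Hg).
    + intros j tj ej Htj Hej. rewrite nth_error_map in Htj, Hej.
      destruct (nth_error ts j) as [u|] eqn:Eu; simpl in Htj; [injection Htj as <-|discriminate].
      destruct (nth_error bs j) as [b|] eqn:Eb; simpl in Hej; [injection Hej as <-|discriminate].
      rewrite Hinst. eauto using has_type_close_lam.
    + intros j tj ej ej' v0 Htj Hej Hej' Hv0. rewrite nth_error_map in Htj, Hej, Hej'.
      destruct (nth_error ts j) as [u|] eqn:Eu; simpl in Htj; [injection Htj as <-|discriminate].
      destruct (nth_error bs j) as [b|] eqn:Eb; simpl in Hej; [injection Hej as <-|discriminate].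
      destruct (nth_error bs' j) as [b'|] eqn:Eb'; simpl in Hej';
        [injection Hej' as <-|discriminate].
      rewrite Hinst in Hv0. rewrite !tm_inst_subst.
      specialize (H3 j u b b' Eu Eb Eb'). rewrite ciu_approx_iff in H3.
      apply H3; [exact Hd|]. apply Subst_scons; assumption.
  - rewrite ty_subst_inst. apply (ciu_closed_tapp obs Hobs).
    + apply (has_type_close D G (Ret v) (TAll t)); assumption.
    + apply wf_ty_subst with (1 := H0). exact Hd.
    + apply (H2 d Hd g Hg).
Qed.

Lemma ciu_approx_precongruence obs : observable obs -> precongruence (ciu_approx obs).
Proof.
  intros Hobs. split.
  - intros D G e e' t (He & He' & _). auto.
  - intros D G e t He. split; [exact He|split; [exact He|]]. auto.
  - intros D G e1 e2 e3 t (H1 & _ & H12) (_ & H3 & H23).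
    split; [exact H1|split; [exact H3|]]. intros d Hd g Hg E HE Ho. auto.
  - apply ciu_approx_compatible. exact Hobs.
Qed.

Lemma ciu_approx_adequate obs : adequate obs (ciu_approx obs).
Proof.
  intros e e' t H Ho. rewrite ciu_approx_iff in H. destruct H as (He & He' & H).
  (* With no free variables the identity substitutions are closing, and the empty stack observes the
     terms themselves. *)
  specialize (H TVar). rewrite ty_subst_id in H. specialize (H ltac:(intros a Ha; lia) VVar).
  rewrite !tm_subst_id in H. apply (H ltac:(intros [|x] u Hx; discriminate) Hole); [|exact Ho].
  intros u Hu. exists t. exact Hu.
Qed.

(** * CIU approximation contains every adequate precongruence *)

Lemma precongruence_ciu_closed obs R e e' t :
  precongruence R -> adequate obs R -> R 0 [] e e' t -> ciu_closed obs e e' t.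
Proof.
  intros HR Hadq H E HE. pose proof (prec_typed HR _ _ _ _ _ H) as [He _].
  apply (Stk_ectx_type _ _ (proj2 (has_type_wf _ _ _ _ He))) in HE as [t' HE].
  (* Adequacy is used at the result type of the stack. That the plugged terms are [R]-related
     follows frame by frame, by reflexivity on the function and compatibility with application. *)
  apply (Hadq _ _ t'). revert t' HE. induction E as [|v E IH]; simpl; intros t' HE.
  - subst. exact H.
  - destruct HE as (t1 & HE & Hv). apply (compat_app (prec_compat HR)) with (t1 := t1); [|auto].
    apply (prec_refl HR). exact Hv.
Qed.

Lemma scons_eta {X : Type} (f : nat -> X) : scons (f 0) (fun i => f (S i)) = f.
Proof. fun_ext. Qed.

(* Related open type variables are closed off one at a time by instantiating the related
   type abstractions; likewise for term variables in the next lemma. *)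
Lemma precongruence_ciu_closed_tysubst obs (Hobs : observable obs) R
  (HR : precongruence R) (Hadq : adequate obs R) D : forall e e' t d,
  TypSubst D d -> R D [] e e' t ->
  ciu_closed obs (tm_subst d VVar e) (tm_subst d VVar e') (ty_subst d t).
Proof.
  induction D as [|D IH]; intros e e' t d Hd H;
    pose proof (prec_typed HR _ _ _ _ _ H) as [He He'].
  - rewrite (tm_subst_closed _ _ _ _ He), (tm_subst_closed _ _ _ _ He').
    replace (ty_subst d t) with t; [eapply precongruence_ciu_closed; eassumption|].
    rewrite <- (ty_subst_id t) at 1.
    apply ty_subst_agree with (1 := proj2 (has_type_wf _ _ _ _ He)). intros; lia.
  - set (d' := fun a => d (S a)).
    assert (Hd' : TypSubst D d') by (intros a Ha; apply Hd; lia).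
    assert (Hd0 : Typ (d 0)) by (apply Hd; lia).
    (* Abstracting type variable 0 leaves [D] variables, closed by the tail [d']; applying the
       result to [d 0] restores [d]. The rule fits because [ctx_shift []] computes to [[]]. *)
    apply (compat_tlam (prec_compat HR) D [] e e' t) in H.
    apply (IH _ _ _ d' Hd') in H. simpl in H.
    apply (ciu_closed_tapp obs Hobs _ _ _ (d 0)) in H; [|constructor|exact Hd0].
    + apply (ciu_closed_det obs Hobs _ _ _ _ _ (det_step_tbeta _ _) (det_step_tbeta _ _)) in H.
      rewrite !tm_tyinst_subst, scons_ty_inst in H. unfold d' in H.
      rewrite !scons_eta in H. exact H.
    + apply (has_type_close_tlam D []); [exact He|exact Hd'|].
      intros [|x] u Hx; discriminate.
Qed.

Lemma precongruence_ciu_closed_subst obs (Hobs : observable obs) R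
  (HR : precongruence R) (Hadq : adequate obs R) D d (Hd : TypSubst D d) G : forall e e' t g,
  Subst (map (ty_subst d) G) g -> R D G e e' t ->
  ciu_closed obs (tm_subst d g e) (tm_subst d g e') (ty_subst d t).
Proof.
  induction G as [|u G IH]; intros e e' t g Hg H;
    pose proof (prec_typed HR _ _ _ _ _ H) as [He He'].
  - replace (tm_subst d g e) with (tm_subst d VVar e);
      [|apply tm_subst_agree with (1 := He); [auto|intros x Hx; inversion Hx]].
    replace (tm_subst d g e') with (tm_subst d VVar e');
      [|apply tm_subst_agree with (1 := He'); [auto|intros x Hx; inversion Hx]].
    exact (precongruence_ciu_closed_tysubst obs Hobs R HR Hadq D _ _ _ _ Hd H).
  - set (g' := fun x => g (S x)).
    assert (Hg' : Subst (map (ty_subst d) G) g') by (intros x w Hx; apply (Hg (S x)); exact Hx).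
    assert (Hg0 : Val (ty_subst d u) (g 0)) by (apply Hg; reflexivity).
    apply (compat_lam (prec_compat HR)) in H.
    apply (IH _ _ _ g' Hg') in H. simpl in H.
    apply (ciu_closed_app obs Hobs _ _ (g 0) (g 0) _ _) in H;
      [|constructor; eauto using has_type_close_lam|exact Hg0|intros E HE Ho; exact Ho].
    apply (ciu_closed_det obs Hobs _ _ _ _ _ (det_step_beta _ _) (det_step_beta _ _)) in H.
    rewrite !tm_inst_subst in H. unfold g' in H. rewrite !scons_eta in H. exact H.
Qed.

Lemma ciu_approx_largest obs : observable obs ->
  largest (fun R => precongruence R /\ adequate obs R) (ciu_approx obs).
Proof.
  intros Hobs. split.
  - split; [exact (ciu_approx_precongruence obs Hobs)|apply ciu_approx_adequate].
  - intros R [HR Hadq] D G e e' t H. apply ciu_approx_iff.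
    pose proof (prec_typed HR _ _ _ _ _ H) as [He He'].
    split; [exact He|split; [exact He'|]]. intros d Hd g Hg.
    exact (precongruence_ciu_closed_subst obs Hobs R HR Hadq D d Hd G _ _ _ _ Hg H).
Qed.

(** [ciu_approx obs] is itself a witness for the existential in [ctx_approx]; conversely any witness
    is an adequate precongruence and hence contained in it. *)
Lemma ciu_approx_iff_ctx_approx obs : observable obs -> forall D G e e' t,
  ciu_approx obs D G e e' t <-> ctx_approx obs D G e e' t.
Proof.
  intros Hobs D G e e' t. pose proof (ciu_approx_largest obs Hobs) as Hciu. split.
  - intros H. exists (ciu_approx obs). auto.
  - intros (R & [HR _] & H). exact (proj2 Hciu R HR _ _ _ _ _ H).
Qed.

Theorem theorem2p8 (D : nat) (G : ctx) (t : ty) (e e' : tm)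
  (He : has_type D G e t) (He' : has_type D G e' t) :
  (ciu_may D G e e' t <-> ctx_may D G e e' t) /\
  (ciu_must D G e e' t <-> ctx_must D G e e' t) /\
  (ciu D G e e' t <-> ctx_both D G e e' t).
Proof.
  pose proof (ciu_approx_iff_ctx_approx _ may_conv_observable D G e e' t) as Hmay.
  pose proof (ciu_approx_iff_ctx_approx _ must_conv_observable D G e e' t) as Hmust.
  unfold ciu, ctx_both, trel_inter, ciu_may, ciu_must, ctx_may, ctx_must. tauto.
Qed.
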